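(* Let $k$ be an algebraically closed field of arbitrary characteristic $\ell$, let $G$ be a finite group, and let $\omega: G\times G\times G\to k^\times$ be a (normalized) 3-cocycle. Let $r=|G|_{\ell'}$ be the part of $|G|$ prime to $\ell$ (that is, $|G|=r\ell^s$ with $(r,\ell)=1$; $r=|G|$ if $\ell=0$). Let $V$ be a finite dimensional module over the twisted quantum double $D^{\omega}(G)$, and let $n$ be a positive integer. Then the image of the braid group $\mathcal{B}_n$ in $\operatorname{End}(V^{\otimes n})$, under the representation given by the braiding of the category of finite dimensional $D^\omega(G)$-modules, is finite. More specifically, this image is a quotient of a subgroup of the full monomial group $G(r,1,m)$ for $m=|G|^{2n}$.
   Context: **Braid group.** $\mathcal{B}_n$ is the group with generators $\beta_1,\dots,\beta_{n-1}$ and relations $\beta_i\beta_{i+1}\beta_i=\beta_{i+1}\beta_i\beta_{i+1}$ for $1\le i\le n-2$ and $\beta_i\beta_j=\beta_j\beta_i$ for $|i-j|\ge 2$. **Full monomial group.** $G(r,1,m)$ is the multiplicative group of $m\times m$ matrices having exactly one nonzero entry in each row and column, all of whose nonzero entries are $r$-th roots of unity. **3-cocycle.** $\omega$ satisfies $\omega(a,b,c)\,\omega(a,bc,d)\,\omega(b,c,d)=\omega(ab,c,d)\,\omega(a,b,cd)$ for all $a,b,c,d\in G$; normalized means $\omega(a,b,c)=1$ whenever one of $a,b,c$ is the identity $e$ of $G$. **Twisted quantum double.** $D^\omega(G)$ is the quasi-Hopf algebra with underlying vector space $(kG)^*\otimes kG$, with basis $\delta_x\overline{g}:=\delta_x\otimes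 g$ ($x,g\in G$), where $\delta_x\in (kG)^*$ is the function with $\delta_x(h)=\delta_{x,h}$. Multiplication: $$(\delta_x\overline{g})(\delta_y\overline{h})=\theta_x(g,h)\,\delta_{x,gyg^{-1}}\,\delta_x\overline{gh},\qquad \theta_x(g,h)=\frac{\omega(x,g,h)\,\omega(g,h,h^{-1}g^{-1}xgh)}{\omega(g,g^{-1}xg,h)}.$$ Write $\delta_x=\delta_x\overline{e}$ and $\overline{g}=\sum_{x\in G}\delta_x\overline{g}$; the unit is $\overline{e}$. Coproduct: $$\Delta(\delta_x\overline{g})=\sum_{yz=x}\gamma_g(y,z)\,\delta_y\overline{g}\otimes\delta_z\overline{g},\qquad \gamma_g(y,z)=\frac{\omega(y,z,g)\,\omega(g,g^{-1}yg,g^{-1}zg)}{\omega(y,g,g^{-1}zg)}.$$ The associator is $\Phi=\sum_{a,b,c\in G}\omega(a,b,c)^{-1}\delta_a\otimes\delta_b\otimes\delta_c$, and the universal $R$-matrix is $R=\sum_{g\in G}\delta_g\otimes\overline{g}$. **Braided category and braid group representations.** Finite dimensional (left) $D^\omega(G)$-modules form a braided tensor category: the tensor product over $k$ is a module via $\Delta$; the associativity isomorphism $(X\otimes Y)\otimes Z\to X\otimes(Y\otimes Z)$ is the action of $\Phi$; the braiding $c_{X,Y}:X\otimes Y\to Y\otimes X$ is $c_{X,Y}=\sigma\circ R$, i.e. the action of $R$ followed by the flip $\sigma$. For a module $V$, the representation of $\mathcal{B}_n$ on $V^{\otimes n}$ sends $\beta_i$ to $\check R_i=\mathrm{Id}_V^{\otimes(i-1)}\otimes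 c_{V,V}\otimes\mathrm{Id}_V^{\otimes(n-i-1)}$. Here $V^{\otimes n}$ is taken with a fixed bracketing, and $\check R_i$ is understood up to inserting associativity isomorphisms: pass to a bracketing in which the factors $i,i+1$ are bracketed together, apply $c_{V,V}$ to them, and pass back. (Different choices of the fixed bracketing give isomorphic representations.)
   Formalization: The claim that the image is a quotient of a subgroup of G(r,1,m) is stated except when G is trivial, n ≥ 2 and dim V ≥ 2, where it is false: the braiding is the flip, the image is the symmetric group S_n, and G(1,1,1) is trivial; finiteness is stated in all cases. *)

(* Defs.v *)
From HB Require Import structures.
From mathcomp Require Import all_boot all_order all_fingroup all_algebra.
From mathcomp Require Import all_field ring.
From mathcomp Require Import boolp classical_sets cardinality.

Set Implicit Arguments.
Unset Strict Implicit.
Unset Printing Implicit Defensive.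

Import GRing.Theory.

Local Open Scope ring_scope.

(* Tensor product of finite dimensional vector spaces: tensors are stored by
   their coordinates on the tensor product of the bases [vbasis]; [tlift] is
   the factorization of a bilinear map through the tensor product, see
   [tliftE] and [tens_ext]. *)
Section Tensor.
Variable k : fieldType.
Implicit Types X Y W : vectType k.

Definition tens X Y : vectType k := 'M[k]_(\dim {:X}, \dim {:Y}).

Definition tmul X Y (x : X) (y : Y) : tens X Y :=
  \matrix_(i, j) (coord (vbasis {:X}) i x * coord (vbasis {:Y}) j y).

Definition tlift X Y W (f : X -> Y -> W) (t : tens X Y) : W :=
  \sum_i \sum_j t i j *: f (vbasis {:X})`_i (vbasis {:Y})`_j.

Fact tlift_is_linear X Y W (f : X -> Y -> W) : linear (tlift f).
Proof.
move=> a s t; rewrite /tlift scaler_sumr -big_split /=; apply: eq_bigr => i _.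
rewrite scaler_sumr -big_split /=; apply: eq_bigr => j _.
by rewrite !mxE scalerDl scalerA.
Qed.
HB.instance Definition _ X Y W (f : X -> Y -> W) :=
  GRing.isLinear.Build k (tens X Y) W _ (tlift f) (tlift_is_linear f).

Fact tmul_linearl X Y (y : Y) : linear (fun x : X => tmul x y).
Proof.
by move=> a u v; apply/matrixP => i j; rewrite !mxE linearP /= mulrDl mulrA.
Qed.
Fact tmul_linearr X Y (x : X) : linear (tmul x : Y -> tens X Y).
Proof.
by move=> a u v; apply/matrixP => i j; rewrite !mxE linearP /= mulrDr mulrCA.
Qed.

Fact tmul_suml I (r : seq I) X Y (F : I -> X) (y : Y) :
  tmul (\sum_(i <- r) F i) y = \sum_(i <- r) tmul (F i) y.
Proof.
pose f (x : X) := tmul x y.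
pose fL := GRing.isLinear.Build _ _ _ _ f (tmul_linearl y).
exact: (linear_sum (HB.pack f fL : {linear _ -> _})).
Qed.
Fact tmul_sumr I (r : seq I) X Y (x : X) (F : I -> Y) :
  tmul x (\sum_(i <- r) F i) = \sum_(i <- r) tmul x (F i).
Proof.
pose fL := GRing.isLinear.Build _ _ _ _ (tmul x : Y -> _) (tmul_linearr x).
exact: (linear_sum (HB.pack (tmul x : Y -> _) fL : {linear _ -> _})).
Qed.

Definition bilin X Y W (f : X -> Y -> W) : Prop :=
  (forall y, linear (f^~ y)) /\ (forall x, linear (f x)).

Lemma tliftE X Y W (f : X -> Y -> W) x y :
  bilin f -> tlift f (tmul x y) = f x y.
Proof.
case=> fl fr.
pose fL y := GRing.isLinear.Build _ _ _ _ (f^~ y) (fl y).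
pose fLy y : {linear X -> W} := HB.pack (f^~ y) (fL y).
pose fR x := GRing.isLinear.Build _ _ _ _ (f x) (fr x).
pose fRx x : {linear Y -> W} := HB.pack (f x) (fR x).
rewrite /tlift.
rewrite {2}(coord_vbasis (memvf x)) -[RHS]/(fLy y _) linear_sum /=.
apply: eq_bigr => i _.
rewrite -[f _ y]/(fLy y _) linearZ /= {2}(coord_vbasis (memvf y)).
rewrite -[f _ (\sum_(i < _) _)]/(fRx _ _) linear_sum /= scaler_sumr.
by apply: eq_bigr => j _; rewrite -[f _ (_ *: _)]/(fRx _ _) linearZ scalerA mxE.
Qed.

Lemma tens_ext X Y W (f g : {linear tens X Y -> W}) :
  (forall x y, f (tmul x y) = g (tmul x y)) -> f =1 g.
Proof.
move=> fg t.
have -> : t = \sum_i \sum_j t i j *: tmul (vbasis {:X})`_i (vbasis {:Y})`_j.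
  apply/matrixP => i j.
  rewrite summxE (bigD1 i) //= [X in _ + X]big1 => [|i' ne_i].
    rewrite addr0 summxE (bigD1 j) //= [X in _ + X]big1 => [|j' ne_j].
      rewrite addr0 !mxE !coord_free ?(basis_free (vbasisP _)) //.
      by rewrite !eqxx !mulr1.
    rewrite !mxE !coord_free ?(basis_free (vbasisP _)) //.
    by rewrite (negPf ne_j) !mulr0.
  rewrite summxE big1 // => j' _.
  rewrite !mxE !coord_free ?(basis_free (vbasisP _)) //.
  by rewrite (negPf ne_i) mul0r mulr0.
rewrite !linear_sum; apply: eq_bigr => i _.
by rewrite !linear_sum; apply: eq_bigr => j _; rewrite !linearZ fg.
Qed.

End Tensor.

Record cocycle3 (gT : finGroupType) (k : fieldType) := Cocycle3 {
  cocycle_fun :> gT -> gT -> gT -> k;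
  cocycle_neq0 : forall a b c, cocycle_fun a b c != 0;
  cocycleP : forall a b c d,
    cocycle_fun a b c * cocycle_fun a (b * c)%g d * cocycle_fun b c d =
    cocycle_fun (a * b)%g c d * cocycle_fun a b (c * d)%g;
  cocycle_normalized : forall a b c,
    [|| a == 1%g, b == 1%g | c == 1%g] -> cocycle_fun a b c = 1 }.

(* An element of the twisted double is the function giving its coordinates on
   the basis of the [dbase w x g]. *)
Definition tqd (gT : finGroupType) (k : fieldType) (w : cocycle3 gT k) : Type :=
  {ffun gT * gT -> k^o}.
HB.instance Definition _ gT k (w : cocycle3 gT k) :=
  Vector.copy (tqd w) {ffun gT * gT -> k^o}.

Section TwistedDouble.
Variables (gT : finGroupType) (k : fieldType) (w : cocycle3 gT k).
Implicit Types (x y z g h : gT) (p q : gT * gT).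

(* MathComp's [x ^ g] is the conjugate g^-1 x g. *)
Definition theta x g h : k := w x g h * w g h (x ^ (g * h))%g / w g (x ^ g)%g h.
Definition gamma g y z : k :=
  w y z g * w g (y ^ g)%g (z ^ g)%g / w y g (z ^ g)%g.

Local Notation tqd := (tqd w).

Definition dbase x g : tqd := [ffun p => (p == (x, g))%:R].

Definition tqd_mul_base p q : tqd :=
  if p.1 == (q.1 ^ p.2^-1)%g
  then theta p.1 p.2 q.2 *: dbase p.1 (p.2 * q.2)%g else 0.

Definition tqd_mul (a b : tqd) : tqd :=
  \sum_p \sum_q (a p * b q) *: tqd_mul_base p q.

Definition gbar g : tqd := \sum_x dbase x g.

Fact tqd_sum_base (a : tqd) : a = \sum_p (a p : k) *: dbase p.1 p.2.
Proof.
apply/ffunP => p; rewrite sum_ffunE (bigD1 p) //= big1 => [|q ne_q].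
  by rewrite !ffunE -surjective_pairing eqxx addr0 [RHS]mulr1.
by rewrite !ffunE -surjective_pairing eq_sym (negPf ne_q) [LHS]mulr0.
Qed.

Fact tqd_mul_linearl (b : tqd) : linear (tqd_mul^~ b).
Proof.
move=> c u v; rewrite /tqd_mul scaler_sumr -big_split; apply: eq_bigr => p _.
rewrite scaler_sumr -big_split; apply: eq_bigr => q _ /=.
by rewrite !ffunE mulrDl scalerDl scalerA mulrA.
Qed.
Fact tqd_mul_linearr (a : tqd) : linear (tqd_mul a).
Proof.
move=> c u v; rewrite /tqd_mul scaler_sumr -big_split; apply: eq_bigr => p _.
rewrite scaler_sumr -big_split; apply: eq_bigr => q _ /=.
by rewrite !ffunE mulrDr scalerDl scalerA mulrCA.
Qed.
Definition tqd_rmul b a := tqd_mul a b.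
HB.instance Definition _ b :=
  GRing.isLinear.Build k tqd tqd _ (tqd_rmul b) (tqd_mul_linearl b).
HB.instance Definition _ a :=
  GRing.isLinear.Build k tqd tqd _ (tqd_mul a) (tqd_mul_linearr a).

Fact tqd_mulE x g y h :
  tqd_mul (dbase x g) (dbase y h) = tqd_mul_base (x, g) (y, h).
Proof.
set p := (x, g); set q := (y, h).
rewrite /tqd_mul (bigD1 p) //= [X in _ + X]big1 => [|p' ne_p].
  rewrite addr0 (bigD1 q) //= [X in _ + X]big1 => [|q' ne_q].
    by rewrite !ffunE !eqxx mulr1 scale1r addr0.
  by rewrite !ffunE (negPf ne_q) mulr0 scale0r.
rewrite big1 // => q' _.
by rewrite !ffunE (negPf ne_p) mul0r scale0r.
Qed.

Lemma tqd_ext (W : lmodType k) (f f' : {linear tqd -> W}) :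
  (forall x g, f (dbase x g) = f' (dbase x g)) -> f =1 f'.
Proof.
move=> ff' a; rewrite (tqd_sum_base a) !linear_sum.
by apply: eq_bigr => p _; rewrite !linearZ_LR ff'.
Qed.

Fact tqd_ext_linear (W : lmodType k) (f f' : tqd -> W) :
  linear f -> linear f' ->
  (forall x g, f (dbase x g) = f' (dbase x g)) -> f =1 f'.
Proof.
move=> lf lf'; pose F := GRing.isLinear.Build _ _ _ _ f lf.
pose F' := GRing.isLinear.Build _ _ _ _ f' lf'.
exact: (@tqd_ext W (HB.pack f F) (HB.pack f' F')).
Qed.

Let w_neq0 := cocycle_neq0 w.
Let w_eq1 := cocycle_normalized w.

Let wP a b c d ab bc cd :
  (ab = a * b)%g -> (bc = b * c)%g -> (cd = c * d)%g ->
  w a b c * w a bc d * w b c d = w ab c d * w a b cd.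
Proof. by move=> -> -> ->; apply: cocycleP. Qed.

Let wP1 a b c d ab bc cd :
  (ab = a * b)%g -> (bc = b * c)%g -> (cd = c * d)%g ->
  w a b c = w ab c d * w a b cd / (w a bc d * w b c d).
Proof. by move=> e1 e2 e3; rewrite -(wP e1 e2 e3); field; rewrite !w_neq0. Qed.

Let wP2 a b c d ab bc cd :
  (ab = a * b)%g -> (bc = b * c)%g -> (cd = c * d)%g ->
  w a bc d = w ab c d * w a b cd / (w a b c * w b c d).
Proof. by move=> e1 e2 e3; rewrite -(wP e1 e2 e3); field; rewrite !w_neq0. Qed.

Let wP5 a b c d ab bc cd :
  (ab = a * b)%g -> (bc = b * c)%g -> (cd = c * d)%g ->
  w a b cd = w a b c * w a bc d * w b c d / w ab c d.
Proof. by move=> e1 e2 e3; rewrite (wP e1 e2 e3); field; rewrite !w_neq0. Qed.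

Fact theta_assoc x g h l :
  theta x g h * theta x (g * h)%g l =
  theta x g (h * l)%g * theta (x ^ g)%g h l.
Proof.
rewrite /theta -!conjgM mulgA.
set y := (x ^ g)%g; set z := (x ^ (g * h))%g; set v := (x ^ (g * h * l))%g.
have xg : (x * g = g * y)%g by rewrite /y conjgE mulVKg.
have yh : (y * h = h * z)%g by rewrite /z conjgM -/y conjgE mulVKg.
have zl : (z * l = l * v)%g by rewrite /v conjgM -/z conjgE mulVKg.
rewrite (@wP1 x g h l (x * g) (g * h) (h * l))%g //.
rewrite (@wP1 g y h l (x * g) (y * h) (h * l))%g //.
rewrite (@wP1 g h z l (g * h) (y * h) (z * l))%g //.
rewrite (@wP5 g h l v (g * h) (h * l) (z * l))%g //.
by field; rewrite !w_neq0.
Qed.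

Fact gamma_theta b c g h :
  theta (b * c)%g g h * gamma (g * h)%g b c =
  theta b g h * theta c g h * gamma g b c * gamma h (b ^ g)%g (c ^ g)%g.
Proof.
rewrite /theta /gamma -!conjgM !(conjMg b c).
set b1 := (b ^ g)%g; set b2 := (b ^ (g * h))%g.
set c1 := (c ^ g)%g; set c2 := (c ^ (g * h))%g.
have bg : (b * g = g * b1)%g by rewrite /b1 conjgE mulVKg.
have bh : (b1 * h = h * b2)%g by rewrite /b2 conjgM -/b1 conjgE mulVKg.
have cg : (c * g = g * c1)%g by rewrite /c1 conjgE mulVKg.
have ch : (c1 * h = h * c2)%g by rewrite /c2 conjgM -/c1 conjgE mulVKg.
rewrite (@wP5 b c g h (b * c) (c * g) (g * h))%g //.
rewrite (@wP1 b g c1 h (b * g) (c * g) (c1 * h))%g //.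
rewrite (@wP2 b g h c2 (b * g) (g * h) (c1 * h))%g //.
rewrite (@wP1 g b1 c1 h (b * g) (b1 * c1) (c1 * h))%g //.
rewrite (@wP1 g b1 h c2 (b * g) (b1 * h) (c1 * h))%g //.
rewrite (@wP5 g h b2 c2 (g * h) (b1 * h) (b2 * c2))%g //.
by field; rewrite !w_neq0.
Qed.

Fact tqd_mulA : associative tqd_mul.
Proof.
move=> a b c.
apply: (tqd_ext (f := tqd_rmul (tqd_mul b c))
                (f' := tqd_rmul c \o tqd_rmul b)) => x g /=; rewrite /tqd_rmul.
apply: (tqd_ext (f := tqd_mul (dbase x g) \o tqd_rmul c)
                (f' := tqd_rmul c \o tqd_mul (dbase x g))) => y h /=.
rewrite /tqd_rmul.
apply: (tqd_ext (f := tqd_mul (dbase x g) \o tqd_mul (dbase y h))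
         (f' := tqd_mul (tqd_mul (dbase x g) (dbase y h)))) => z l /=.
rewrite !tqd_mulE /tqd_mul_base /=.
have [yz|ne_yz] := eqVneq y (z ^ h^-1)%g; last first.
  rewrite linear0; case: ifP => [/eqP xy|_];
    rewrite -[RHS]/(tqd_rmul _ _) ?linear0 //.
  rewrite linearZ_LR /= /tqd_rmul tqd_mulE /tqd_mul_base /=.
  case: eqP => [xz|_]; last by rewrite scaler0.
  case/eqP: ne_yz; apply: (@conjg_inj _ g^-1%g).
  by rewrite -xy xz invMg conjgM.
rewrite linearZ_LR /= tqd_mulE /tqd_mul_base /=.
case: (eqVneq x (y ^ g^-1)%g) => [xy|_]; last first.
  by rewrite scaler0 -[RHS]/(tqd_rmul _ _) linear0.
rewrite -[RHS]/(tqd_rmul _ _) [RHS]linearZ_LR /=.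
rewrite /tqd_rmul tqd_mulE /tqd_mul_base /=.
have -> : x = (z ^ (g * h)^-1)%g by rewrite xy yz invMg conjgM.
rewrite eqxx !scalerA theta_assoc mulgA mulrC; congr (_ * _ *: _).
by rewrite yz invMg conjgM conjgKV.
Qed.

Fact theta1l x h : theta x 1%g h = 1.
Proof. by rewrite /theta !w_eq1 ?eqxx ?orbT // mulr1 divr1. Qed.
Fact theta1r x g : theta x g 1%g = 1.
Proof. by rewrite /theta !w_eq1 ?eqxx ?orbT // mulr1 divr1. Qed.

Fact tqd_mul1 : left_id (gbar 1) tqd_mul.
Proof.
apply: (tqd_ext (f := tqd_mul (gbar 1)) (f' := idfun)) => y h /=.
rewrite -[LHS]/(tqd_rmul _ _) linear_sum (bigD1 y) //= big1 => [|x ne_x].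
  by rewrite /tqd_rmul tqd_mulE /tqd_mul_base /= invg1 conjg1 eqxx theta1l
             mul1g scale1r addr0.
by rewrite /tqd_rmul tqd_mulE /tqd_mul_base /= invg1 conjg1 (negPf ne_x).
Qed.
Fact tqd_mulr1 : right_id (gbar 1) tqd_mul.
Proof.
apply: (tqd_ext (f := tqd_rmul (gbar 1)) (f' := idfun)) => y h /=.
rewrite /tqd_rmul linear_sum (bigD1 (y ^ h)%g) //= big1 => [|x ne_x].
  by rewrite tqd_mulE /tqd_mul_base /= conjgK eqxx theta1r mulg1 scale1r addr0.
rewrite tqd_mulE /tqd_mul_base /=; case: eqP => // yx.
by case/eqP: ne_x; rewrite yx conjgKV.
Qed.

Fact tqd_1_neq0 : gbar 1 != 0.
Proof.
apply/eqP => /ffunP/(_ (1, 1)%g)/eqP; rewrite sum_ffunE ffunE (bigD1 1%g) //=.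
rewrite big1 => [|x ne_x]; first by rewrite ffunE eqxx addr0 oner_eq0.
by rewrite ffunE xpair_eqE eq_sym (negPf ne_x).
Qed.

Fact tqd_mulDl : left_distributive tqd_mul +%R.
Proof. by move=> a b c; rewrite -!/(tqd_rmul _ _) linearD. Qed.
Fact tqd_mulDr : right_distributive tqd_mul +%R.
Proof. by move=> a b c; rewrite linearD. Qed.

HB.instance Definition _ := GRing.Zmodule_isNzRing.Build tqd
  tqd_mulA tqd_mul1 tqd_mulr1 tqd_mulDl tqd_mulDr tqd_1_neq0.

Fact tqd_scaleAl (c : k) (a b : tqd) : c *: (a * b) = c *: a * b.
Proof. by rewrite -[c *: a * b]/(tqd_rmul _ _) linearZ_LR. Qed.
HB.instance Definition _ := GRing.Lmodule_isLalgebra.Build k tqd tqd_scaleAl.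

Fact tqd_scaleAr (c : k) (a b : tqd) : c *: (a * b) = a * (c *: b).
Proof. by rewrite -[a * (c *: b)]/(tqd_mul _ _) linearZ_LR. Qed.
HB.instance Definition _ := GRing.Lalgebra_isAlgebra.Build k tqd tqd_scaleAr.
HB.instance Definition _ := Algebra_isFalgebra.Build k tqd.

Lemma dbaseM x g y h : dbase x g * dbase y h =
  if x == (y ^ g^-1)%g then theta x g h *: dbase x (g * h)%g else 0.
Proof. exact: tqd_mulE. Qed.

Lemma tqd1E : 1 = gbar 1.
Proof. by []. Qed.

(* [tens tqd tqd] and [tens tqd (tens tqd tqd)] stand for D (x) D and
   D (x) D (x) D. *)
Definition tqd_coproduct (a : tqd) : tens tqd tqd :=
  \sum_(p : gT * gT) (a p : k) *: \sum_(yz : gT * gT | (yz.1 * yz.2)%g == p.1)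
    gamma p.2 yz.1 yz.2 *: tmul (dbase yz.1 p.2) (dbase yz.2 p.2).

Definition tqd_Phi : tens tqd (tens tqd tqd) :=
  \sum_a \sum_b \sum_c
    (w a b c)^-1 *: tmul (dbase a 1) (tmul (dbase b 1) (dbase c 1)).

Definition tqd_R : tens tqd tqd := \sum_g tmul (dbase g 1) (gbar g).

Fact tqd_coproduct_is_linear : linear tqd_coproduct.
Proof.
move=> c a b; rewrite /tqd_coproduct scaler_sumr -big_split /=.
by apply: eq_bigr => p _; rewrite !ffunE scalerDl scalerA.
Qed.
HB.instance Definition _ := GRing.isLinear.Build k tqd (tens tqd tqd) _
  tqd_coproduct tqd_coproduct_is_linear.

Lemma coproduct_dbase x g : tqd_coproduct (dbase x g) =
  \sum_(yz : gT * gT | (yz.1 * yz.2)%g == x)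
    gamma g yz.1 yz.2 *: tmul (dbase yz.1 g) (dbase yz.2 g).
Proof.
rewrite /tqd_coproduct (bigD1 (x, g)) //= [X in _ + X]big1 => [|p ne_p].
  by rewrite ffunE eqxx scale1r addr0.
by rewrite ffunE (negPf ne_p) scale0r.
Qed.

Lemma coproduct1 : tqd_coproduct 1 = tmul (1 : tqd) (1 : tqd).
Proof.
rewrite [in LHS]tqd1E /gbar linear_sum !tqd1E /gbar tmul_suml.
under [RHS]eq_bigr do rewrite tmul_sumr.
rewrite [RHS]pair_bigA /=.
rewrite [RHS](partition_big (fun yz : gT * gT => (yz.1 * yz.2)%g) xpredT) //=.
apply: eq_bigr => x _; rewrite coproduct_dbase; apply: eq_bigr => -[y z] _ /=.
by rewrite /gamma !w_eq1 ?eqxx ?orbT // mulr1 divr1 scale1r.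
Qed.

End TwistedDouble.

Section TensorMaps.
Variable k : fieldType.
Implicit Types A B X Y Z W : vectType k.

Definition tens_hom X Y X' Y' (f : 'Hom(X, X')) (g : 'Hom(Y, Y')) :
    'Hom(tens X Y, tens X' Y') :=
  linfun (tlift (fun x y => tmul (f x) (g y))).

Definition tens_flip X Y : 'Hom(tens X Y, tens Y X) :=
  linfun (tlift (fun x y => tmul y x)).

Definition tens_reassoc X Y Z :
    'Hom(tens (tens X Y) Z, tens X (tens Y Z)) :=
  linfun (tlift (fun t z => tlift (fun x y => tmul x (tmul y z)) t)).

(* The action of A (x) B on X (x) Y deduced from actions of A on X and of B
   on Y. *)
Definition tens_act A B X Y (f : A -> 'End(X)) (g : B -> 'End(Y)) :
    tens A B -> 'End(tens X Y) :=
  tlift (fun a b => tens_hom (f a) (g b)).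
HB.instance Definition _ A B X Y (f : A -> 'End(X)) (g : B -> 'End(Y)) :=
  GRing.Linear.on (tens_act f g).

Lemma tens_homE X Y X' Y' (f : 'Hom(X, X')) (g : 'Hom(Y, Y')) x y :
  tens_hom f g (tmul x y) = tmul (f x) (g y).
Proof.
rewrite lfunE /= tliftE //.
by split=> v a u u' /=; rewrite linearP ?tmul_linearl ?tmul_linearr.
Qed.

Lemma tens_flipE X Y (x : X) (y : Y) : tens_flip X Y (tmul x y) = tmul y x.
Proof.
rewrite lfunE /= (@tliftE _ _ _ _ (fun x y => tmul y x)) //.
by split=> v a u u' /=; rewrite ?tmul_linearl ?tmul_linearr.
Qed.

Lemma tens_reassocE X Y Z (x : X) (y : Y) (z : Z) :
  tens_reassoc X Y Z (tmul (tmul x y) z) = tmul x (tmul y z).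
Proof.
have bil z' : bilin (fun (x : X) (y : Y) => tmul x (tmul y z')).
  by split=> v a u u' /=; rewrite ?tmul_linearl ?tmul_linearr.
rewrite lfunE /= tliftE ?tliftE //; split=> v a u u' /=.
  by rewrite linearP.
rewrite /tlift scaler_sumr -big_split; apply: eq_bigr => i _ /=.
rewrite scaler_sumr -big_split; apply: eq_bigr => j _ /=.
by rewrite !tmul_linearr scalerDr !scalerA mulrC.
Qed.

Lemma tens_lfun_ext X Y W (f g : 'Hom(tens X Y, W)) :
  (forall x y, f (tmul x y) = g (tmul x y)) -> f = g.
Proof. by move=> fg; apply/lfunP; apply: tens_ext. Qed.

Lemma tens_actE A B X Y (f : {linear A -> 'End(X)}) (g : {linear B -> 'End(Y)})
    a b :
  tens_act f g (tmul a b) = tens_hom (f a) (g b).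
Proof.
rewrite /tens_act tliftE //.
split=> [b' | a'] c u v; apply: tens_lfun_ext => x y.
  by rewrite add_lfunE scale_lfunE !tens_homE linearP add_lfunE scale_lfunE
             tmul_linearl.
by rewrite add_lfunE scale_lfunE !tens_homE linearP add_lfunE scale_lfunE
           tmul_linearr.
Qed.

Lemma tens_hom_comp X Y X1 Y1 X2 Y2 (f : 'Hom(X1, X2)) (g : 'Hom(Y1, Y2))
    (f' : 'Hom(X, X1)) (g' : 'Hom(Y, Y1)) :
  (tens_hom f g \o tens_hom f' g')%VF = tens_hom (f \o f')%VF (g \o g')%VF.
Proof.
by apply: tens_lfun_ext => x y; rewrite comp_lfunE !tens_homE !comp_lfunE.
Qed.

Lemma tens_homZ X Y X' Y' a b (f : 'Hom(X, X')) (g : 'Hom(Y, Y')) :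
  tens_hom (a *: f) (b *: g) = (a * b) *: tens_hom f g.
Proof.
apply: tens_lfun_ext => x y; rewrite scale_lfunE !tens_homE !scale_lfunE.
by apply/matrixP => i j; rewrite !mxE !linearZ /= mulrACA.
Qed.

Lemma tens_hom0l X Y X' Y' (g : 'Hom(Y, Y')) :
  tens_hom (0 : 'Hom(X, X')) g = 0.
Proof. by rewrite -(scale0r 0) -(scale1r g) tens_homZ mul0r scale0r. Qed.
Lemma tens_hom0r X Y X' Y' (f : 'Hom(X, X')) :
  tens_hom f (0 : 'Hom(Y, Y')) = 0.
Proof. by rewrite -(scale0r 0) -(scale1r f) tens_homZ mulr0 scale0r. Qed.

Lemma tens_hom1 X Y : tens_hom \1%VF \1%VF = \1%VF :> 'End(tens X Y).
Proof. by apply: tens_lfun_ext => x y; rewrite tens_homE !id_lfunE. Qed.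

End TensorMaps.

Record tqd_module (gT : finGroupType) (k : fieldType) (w : cocycle3 gT k) :=
  TqdModule {
    tqd_space :> vectType k;
    tqd_act : {linear tqd w -> 'End(tqd_space)};
    tqd_act1 : tqd_act 1 = \1%VF;
    tqd_actM : forall a b, tqd_act (a * b) = (tqd_act a \o tqd_act b)%VF }.

Section Modules.
Variables (gT : finGroupType) (k : fieldType) (w : cocycle3 gT k).
Implicit Types M N P : tqd_module w.

Definition tqd_tens_act M N : tqd w -> 'End(tens M N) :=
  tens_act (tqd_act M) (tqd_act N) \o @tqd_coproduct _ _ w.
HB.instance Definition _ M N := GRing.Linear.on (tqd_tens_act M N).

Fact tqd_tens_act1 M N : tqd_tens_act M N 1 = \1%VF.
Proof.
by rewrite /tqd_tens_act /= coproduct1 tens_actE !tqd_act1 tens_hom1.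
Qed.

Fact tqd_tens_act_dbase M N x g : tqd_tens_act M N (dbase w x g) =
  \sum_(yz : gT * gT | (yz.1 * yz.2)%g == x) gamma w g yz.1 yz.2 *:
    tens_hom (tqd_act M (dbase w yz.1 g)) (tqd_act N (dbase w yz.2 g)).
Proof.
rewrite /tqd_tens_act /= coproduct_dbase linear_sum; apply: eq_bigr => yz _.
by rewrite linearZ_LR /= tens_actE.
Qed.

Fact tqd_tens_actM M N a b :
  tqd_tens_act M N (a * b) = (tqd_tens_act M N a \o tqd_tens_act M N b)%VF.
Proof.
pose T : {linear tqd w -> _} := tqd_tens_act M N.
rewrite -[tqd_tens_act M N]/(T : _ -> _).
have lin1 c : linear (fun a => T (a * c)).
  by move=> s u v; rewrite mulrDl -scalerAl linearP.
have lin2 (F : 'End(tens M N)) : linear (fun a => T a \o F)%VF.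
  by move=> s u v; rewrite linearP comp_lfunDl comp_lfunZl.
have lin3 c : linear (fun a => T (c * a)).
  by move=> s u v; rewrite mulrDr -scalerAr linearP.
have lin4 (F : 'End(tens M N)) : linear (fun a => F \o T a)%VF.
  by move=> s u v; rewrite linearP comp_lfunDr comp_lfunZr.
apply: (tqd_ext_linear (lin1 b) (lin2 (T b))) => x g.
apply: (tqd_ext_linear (lin3 _) (lin4 _)) => y h.
rewrite dbaseM /T /= ![in RHS]tqd_tens_act_dbase.
pose H u v r s := tens_hom (tqd_act M (dbase w u v)) (tqd_act N (dbase w r s)).
have comp_suml I (r : seq I) (Q : pred I) (F : I -> 'End(tens M N)) G :
    (\sum_(i <- r | Q i) F i \o G = \sum_(i <- r | Q i) (F i \o G))%VF.
  by apply: (big_morph (fun F => F \o G)%VF) => [f f'|];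
     [exact: comp_lfunDl | exact: comp_lfun0l].
have comp_sumr I (r : seq I) (Q : pred I) (F : I -> 'End(tens M N)) G :
    (G \o \sum_(i <- r | Q i) F i = \sum_(i <- r | Q i) (G \o F i))%VF.
  by apply: (big_morph (fun F => G \o F)%VF) => [f f'|];
     [exact: comp_lfunDr | exact: comp_lfun0r].
have HH p q : (H p.1 g p.2 g \o H q.1 h q.2 h)%VF =
    if q == (p.1 ^ g, p.2 ^ g)%g
    then (theta w p.1 g h * theta w p.2 g h) *: H p.1 (g * h)%g p.2 (g * h)%g
    else 0.
  rewrite tens_hom_comp -!tqd_actM !dbaseM.
  have eqJ u v : (u == v ^ g^-1)%g = (v == u ^ g)%g.
    by apply/eqP/eqP => ->; rewrite (conjgK, conjgKV).
  case: q => q1 q2 /=; rewrite !eqJ xpair_eqE.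
  case: eqP => _; last by rewrite !linear0 ?tens_hom0l ?tens_hom0r.
  case: eqP => _; last by rewrite !linear0 ?tens_hom0l ?tens_hom0r.
  by rewrite !linearZ tens_homZ.
rewrite comp_suml.
transitivity (\sum_(p : gT * gT | (p.1 * p.2)%g == x)
  if x == (y ^ g^-1)%g then
    (theta w x g h * gamma w (g * h)%g p.1 p.2) *: H p.1 (g * h)%g p.2 (g * h)%g
  else 0).
  case: eqP => _; last by rewrite linear0 big1.
  rewrite linearZ /= tqd_tens_act_dbase scaler_sumr.
  by apply: eq_bigr => p _; rewrite scalerA.
apply: eq_bigr => p /eqP px; rewrite comp_sumr.
under eq_bigr do rewrite -comp_lfunZl -comp_lfunZr HH.
case: eqP => [xy|ne_xy].
  have y_def : (p.1 ^ g * p.2 ^ g = y)%g by rewrite -conjMg px xy conjgKV.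
  rewrite (bigD1 (p.1 ^ g, p.2 ^ g)%g) /= ?y_def // eqxx.
  rewrite big1 ?addr0 => [|q /andP[_ /negPf->]]; last by rewrite !scaler0.
  by rewrite !scalerA -px gamma_theta; congr (_ *: _); ring.
rewrite big1 // => q /eqP qy; case: eqP => [q_def|]; last by rewrite !scaler0.
by case: ne_xy; rewrite -qy q_def /= -conjMg px conjgK.
Qed.

Definition tqd_tens M N : tqd_module w :=
  @TqdModule _ _ w (tens M N) (tqd_tens_act M N)
    (tqd_tens_act1 M N) (@tqd_tens_actM M N).

Definition tqd_braiding M N : 'Hom(tqd_tens M N, tqd_tens N M) :=
  (tens_flip M N \o tens_act (tqd_act M) (tqd_act N) (tqd_R w))%VF.

Definition tqd_assoc M N P :
    'Hom(tqd_tens (tqd_tens M N) P, tqd_tens M (tqd_tens N P)) :=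
  (tens_act (tqd_act M)
     (tens_act (tqd_act N) (tqd_act P)) (tqd_Phi w) \o
   tens_reassoc M N P)%VF.

End Modules.

(* V^(x)n with all brackets to the left, for n > 0 (V^(x)0 is junk). *)
Section TensorPower.
Variables (gT : finGroupType) (k : fieldType) (w : cocycle3 gT k).
Variable V : tqd_module w.

Fixpoint tpow_succ m : tqd_module w :=
  if m is m'.+1 then tqd_tens (tpow_succ m') V else V.

Definition tpow n : tqd_module w := tpow_succ n.-1.

(* The braiding of the last two factors of V^(x)(m + 2). *)
Definition braid_last m : 'End(tpow_succ m.+1) :=
  match m return 'End(tpow_succ m.+1) with
  | 0 => tqd_braiding V V
  | m'.+1 =>
      ((tqd_assoc (tpow_succ m') V V)^-1 \o
       tens_hom \1 (tqd_braiding V V) \o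
       tqd_assoc (tpow_succ m') V V)%VF
  end.

Fixpoint Rcheck_succ m (i : nat) : 'End(tpow_succ m) :=
  match m return 'End(tpow_succ m) with
  | 0 => \1%VF
  | m'.+1 =>
      if (i < m')%N then tens_hom (Rcheck_succ m' i) \1%VF else braid_last m'
  end.

(* Indices start from 0: [Rcheck n i] acts on the factors i and i + 1 of
   {0, .., n - 1}. *)
Definition Rcheck n (i : 'I_n.-1) : 'End(tpow n) := Rcheck_succ n.-1 i.

End TensorPower.

Section BraidGroup.
Variable n : nat.

(* (i, true) stands for beta_i and (i, false) for its inverse. *)
Definition braid_word := seq ('I_n.-1 * bool).
Implicit Types u v : braid_word.

Inductive braid_rel : braid_word -> braid_word -> Prop :=
| braid_refl u : braid_rel u u
| braid_sym u v : braid_rel u v -> braid_rel v u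
| braid_trans u v z : braid_rel u v -> braid_rel v z -> braid_rel u z
| braid_cat u u' v v' :
    braid_rel u u' -> braid_rel v v' -> braid_rel (u ++ v) (u' ++ v')
| braid_cancel i b : braid_rel [:: (i, b); (i, ~~ b)] [::]
| braid_artin (i j : 'I_n.-1) : j = i.+1 :> nat ->
    braid_rel [:: (i, true); (j, true); (i, true)]
              [:: (j, true); (i, true); (j, true)]
| braid_far (i j : 'I_n.-1) : (i.+1 < j)%N ->
    braid_rel [:: (i, true); (j, true)] [:: (j, true); (i, true)].

Definition braid_relb : rel braid_word := fun u v => `[< braid_rel u v >].

Fact braid_relb_refl : reflexive braid_relb.
Proof. by move=> u; apply/asboolP; apply: braid_refl. Qed.
Fact braid_relb_sym : symmetric braid_relb.
Proof. by move=> u v; apply/asboolP/asboolP; apply: braid_sym. Qed.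
Fact braid_relb_trans : transitive braid_relb.
Proof.
by move=> v u z /asboolP uv /asboolP vz; apply/asboolP; apply: braid_trans vz.
Qed.
Canonical braid_equiv :=
  EquivRel braid_relb braid_relb_refl braid_relb_sym braid_relb_trans.

Definition braid : Type := {eq_quot braid_equiv}%qT.
HB.instance Definition _ := Choice.copy braid {eq_quot braid_equiv}%qT.

Definition braid_class u : braid := (\pi_{eq_quot braid_equiv} u)%qT.
Definition braid_gen (i : 'I_n.-1) : braid := braid_class [:: (i, true)].

Definition braid_inv_word u : braid_word := rev [seq (p.1, ~~ p.2) | p <- u].

Let word (x : braid) : braid_word :=
  generic_quotient.repr (x : {eq_quot braid_equiv}%qT).

Definition braid_mul (x y : braid) : braid := braid_class (word x ++ word y).
Definition braid_inv (x : braid) : braid :=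
  braid_class (braid_inv_word (word x)).

Lemma braid_classP u v : braid_class u = braid_class v <-> braid_rel u v.
Proof. by split=> [/eqmodP/asboolP | uv]; last by apply/eqmodP/asboolP. Qed.

Fact word_class u : braid_rel (word (braid_class u)) u.
Proof.
by apply/braid_classP; rewrite /braid_class /word generic_quotient.reprK.
Qed.

Fact class_word x : braid_class (word x) = x.
Proof. by rewrite /braid_class /word generic_quotient.reprK. Qed.

Fact braid_mulE u v :
  braid_mul (braid_class u) (braid_class v) = braid_class (u ++ v).
Proof. by apply/braid_classP; apply: braid_cat; apply: word_class. Qed.

Fact braid_mulA : associative braid_mul.
Proof.
move=> x y z; rewrite -(class_word x) -(class_word y) -(class_word z).
by rewrite !braid_mulE catA.
Qed.
Fact braid_mul1 : left_id (braid_class [::]) braid_mul.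
Proof. by move=> x; rewrite -(class_word x) braid_mulE. Qed.
Fact braid_mulr1 : right_id (braid_class [::]) braid_mul.
Proof. by move=> x; rewrite -(class_word x) braid_mulE cats0. Qed.

Fact braid_mul_inv_word u : braid_rel (u ++ braid_inv_word u) [::].
Proof.
elim: u => [|[i b] u IHu]; first exact: braid_refl.
rewrite /braid_inv_word /= rev_cons -cats1 catA.
apply: braid_trans (braid_cancel i b).
rewrite -[X in braid_rel _ X]/([:: (i, b)] ++ [::] ++ [:: (i, ~~ b)]).
exact: (braid_cat (braid_refl [:: (i, b)]) (braid_cat IHu (braid_refl _))).
Qed.

Fact braid_inv_wordK u : braid_inv_word (braid_inv_word u) = u.
Proof.
rewrite /braid_inv_word map_rev revK -map_comp -[RHS]map_id.
by apply: eq_map => -[i b] /=; rewrite negbK.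
Qed.

Fact braid_mulV : left_inverse (braid_class [::]) braid_inv braid_mul.
Proof.
move=> x; rewrite -{2}(class_word x) braid_mulE; apply/braid_classP.
rewrite -{2}(braid_inv_wordK (word x)); exact: braid_mul_inv_word.
Qed.
Fact braid_mulrV : right_inverse (braid_class [::]) braid_inv braid_mul.
Proof.
move=> x; rewrite -{1}(class_word x) braid_mulE; apply/braid_classP.
exact: braid_mul_inv_word.
Qed.

HB.instance Definition _ := isGroup.Build braid
  braid_mulA braid_mul1 braid_mulr1 braid_mulV braid_mulrV.

End BraidGroup.

Definition braid_representation n (k : fieldType) (W : vectType k)
    (rho : braid n -> 'End(W)) : Prop :=
  rho 1%g = \1%VF /\ forall x y, rho (x * y)%g = (rho x \o rho y)%VF.

Local Open Scope classical_set_scope.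

Definition full_monomial (k : fieldType) (r m : nat) : set 'M[k]_m :=
  [set A | [/\ forall i, exists! j, A i j != 0,
               forall j, exists! i, A i j != 0 &
               forall i j, A i j != 0 -> A i j ^+ r = 1]].

(* S is the image of a subgroup H of G(r, 1, m) under a group morphism.  When S
   is the image of the braid group on n strands acting on V^(x)n, this fails in
   one degenerate case: if G is trivial, dim V >= 2 and n >= 2, then the
   braiding is the flip and S is the symmetric group on n letters, while
   G(1, 1, 1) is trivial. *)
Definition quotient_of_subgroup_of_full_monomial (k : fieldType) (r m : nat)
    (W : vectType k) (S : set 'End(W)) : Prop :=
  exists (H : set 'M[k]_m) (f : 'M[k]_m -> 'End(W)),
    [/\ H `<=` @full_monomial k r m,
        [/\ H 1%:M, (forall A B, H A -> H B -> H (A *m B)) &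
            (forall A, H A -> H (invmx A))],
        (forall A B, H A -> H B -> f (A *m B) = (f A \o f B)%VF) &
        f @` H = S].

(* Main.v *)
Require Import Defs.
From HB Require Import structures.
From mathcomp Require Import all_boot all_order all_fingroup all_algebra.
From mathcomp Require Import all_field ring.
From mathcomp Require Import boolp classical_sets cardinality.

(* The vectors delta_x \bar{g} t span V, and the braid generators permute their
   tensor products up to scalars built from omega.  Multiplying the cocycle
   identity over its first argument shows that omega^|G| is a coboundary, so
   the |G|-th powers of these scalars form a coboundary on the set of basis
   tensors; rescaling each tensor by a |G|-th root makes all scalars |G|-th,
   hence r-th, roots of unity.  The permutations and scalars do not involve the
   vectors t, so they already act on the (G x G)^n tensors of the regular
   module.  Comparing two words on tensors with labels (x, g psi(t)), for
   arbitrary psi : V -> G, shows that their monomial matrices determine their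
   action on V^(x)n as soon as |G| > 1.  Finiteness without this restriction
   follows in the same way from the labels (x, g, phi(t)), phi : V -> bool. *)

Set Implicit Arguments.
Unset Strict Implicit.
Unset Printing Implicit Defensive.

Import GRing.Theory.

Local Open Scope ring_scope.

(** * Homogeneous tensors *)

Section Spanning.
Variable k : fieldType.
Implicit Types X Y Z W : vectType k.

Lemma vspace_full X (U : {vspace X}) : (forall x, x \in U) -> U = fullv.
Proof. by move=> U_x; apply/eqP; rewrite eqEsubv subvf; apply/subvP=> x _. Qed.

(** The projection onto [U] agrees with the identity on pure tensors. Spanning is expressed in this
    form throughout, without choosing combinations. *)
Lemma tens_span X Y (U : {vspace tens X Y}) :
  (forall x y, tmul x y \in U) -> U = fullv.
Proof.
move=> U_xy; apply: vspace_full => t.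
rewrite -[t]/(idfun t) -(@tens_ext _ X Y _ (projv U) idfun) ?memv_proj //.
by move=> x y /=; apply: projv_id.
Qed.

(** Associators and crossings are easily seen to be onto; counting dimensions then makes them
    invertible. *)
Lemma surjective_lker0 X Y (f : 'Hom(X, Y)) :
  \dim {:X} = \dim {:Y} -> limg f = fullv -> lker f == 0%VS.
Proof.
move=> dimXY f_surj; rewrite -dimv_eq0.
have := limg_ker_dim f fullv.
by rewrite f_surj capfv dimXY => /eqP; rewrite -[X in _ == X]add0n eqn_add2r.
Qed.

Lemma dim_tens X Y : \dim {:tens X Y} = (\dim {:X} * \dim {:Y})%N.
Proof. by rewrite dimvf. Qed.

Lemma tens_dimA X Y Z :
  \dim {:tens (tens X Y) Z} = \dim {:tens X (tens Y Z)}.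
Proof. by rewrite !dim_tens mulnA. Qed.

Lemma memvZ_inv X (U : {vspace X}) c x : c != 0 -> c *: x \in U -> x \in U.
Proof. by move=> c0; rewrite rpredZeq (negPf c0). Qed.

Lemma tmul0l X Y (y : Y) : tmul (0 : X) y = 0.
Proof. by apply/matrixP => i j; rewrite !mxE linear0 mul0r. Qed.

Lemma tmul0r X Y (x : X) : tmul x (0 : Y) = 0.
Proof. by apply/matrixP => i j; rewrite !mxE linear0 mulr0. Qed.

Lemma tmulZl X Y c (x : X) (y : Y) :
  tmul (c *: x) y = c *: tmul x y.
Proof. by apply/matrixP => i j; rewrite !mxE linearZ /= mulrA. Qed.

Lemma tmulZr X Y c (x : X) (y : Y) :
  tmul x (c *: y) = c *: tmul x y.
Proof. by apply/matrixP => i j; rewrite !mxE linearZ /= mulrCA. Qed.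

Lemma lfun_ext_span W (F G : 'End(W)) (I : Type) (b : I -> W) :
  (forall U : {vspace W}, (forall i, b i \in U) -> U = fullv) ->
  (forall i, F (b i) = G (b i)) -> F = G.
Proof.
move=> b_span FG; apply/lfunP => x; apply/eqP; rewrite -subr_eq0.
rewrite -opp_lfunE -add_lfunE -memv_ker (b_span (lker (F - G))) ?memvf //.
by move=> i; rewrite memv_ker add_lfunE opp_lfunE FG subrr.
Qed.

End Spanning.

(** * The grading of modules by $G$; braiding and associator on homogeneous vectors *)

Section Homogeneous.
Variables (gT : finGroupType) (k : fieldType) (w : cocycle3 gT k).
Implicit Types (M N P : tqd_module w) (a b c g h x y : gT).

(** The $\delta_x$ are orthogonal idempotents of sum 1, so they grade [M] by $G$. The zero vector
    has every degree. *)
Definition homogeneous M x (v : M) : Prop := tqd_act M (dbase w x 1%g) v = v.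

Lemma dbase_homogeneous M x g (v : M) :
  homogeneous x (tqd_act M (dbase w x g) v).
Proof.
rewrite /homogeneous -comp_lfunE -tqd_actM dbaseM invg1 conjg1 eqxx.
by rewrite theta1l scale1r mul1g.
Qed.

Lemma dbase_hom M x y g (v : M) : homogeneous x v ->
  y != (x ^ g^-1)%g -> tqd_act M (dbase w y g) v = 0.
Proof.
move=> v_x y_x; rewrite -v_x -comp_lfunE -tqd_actM dbaseM (negPf y_x).
by rewrite linear0 lfunE.
Qed.

Lemma dbase1_hom M x y (v : M) : homogeneous x v ->
  tqd_act M (dbase w y 1%g) v = if y == x then v else 0.
Proof.
move=> v_x; case: eqP => [->//|/eqP yx]; apply: dbase_hom v_x _.
by rewrite invg1 conjg1.
Qed.

(** On a vector of degree $x$, only the summand $\delta_{gxg^{-1}}\overline{g}$ of $\overline{g}$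
    survives. *)
Lemma gbar_hom M x g (v : M) : homogeneous x v ->
  tqd_act M (gbar w g) v = tqd_act M (dbase w (x ^ g^-1)%g g) v.
Proof.
move=> v_x; rewrite /gbar linear_sum sum_lfunE (bigD1 (x ^ g^-1)%g) //= big1.
  by rewrite addr0.
by move=> y y_x; apply: dbase_hom v_x y_x.
Qed.

Lemma gbar_homogeneous M x g (v : M) : homogeneous x v ->
  homogeneous (x ^ g^-1)%g (tqd_act M (gbar w g) v).
Proof. by move=> v_x; rewrite (gbar_hom g v_x); apply: dbase_homogeneous. Qed.

Lemma gbar_dbase M x g h (v : M) :
  tqd_act M (gbar w g) (tqd_act M (dbase w x h) v) =
  theta w (x ^ g^-1)%g g h *: tqd_act M (dbase w (x ^ g^-1)%g (g * h)%g) v.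
Proof.
rewrite (gbar_hom _ (dbase_homogeneous _ _ _)).
by rewrite -comp_lfunE -tqd_actM dbaseM eqxx linearZ scale_lfunE.
Qed.

Lemma homogeneous_sum M (v : M) :
  v = \sum_x tqd_act M (dbase w x 1%g) v.
Proof.
by rewrite -[LHS](id_lfunE v) -tqd_act1 tqd1E /gbar linear_sum sum_lfunE.
Qed.

Lemma homogeneous_tens_span M N (U : {vspace tens M N}) :
  (forall x y u v, homogeneous x u -> homogeneous y v -> tmul u v \in U) ->
  U = fullv.
Proof.
move=> U_xy; apply: tens_span => u v.
rewrite (homogeneous_sum u) (homogeneous_sum v) tmul_suml.
apply: memv_suml => x _; rewrite tmul_sumr; apply: memv_suml => y _.
by apply: U_xy; apply: dbase_homogeneous.
Qed.

Lemma gamma1 y z : gamma w 1%g y z = 1.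
Proof. by rewrite /gamma !cocycle_normalized ?eqxx ?orbT // divr1 mulr1. Qed.

Lemma tmul_homogeneous M N x y (u : M) (v : N) :
  homogeneous x u -> homogeneous y v ->
  @homogeneous (tqd_tens M N) (x * y)%g (tmul u v).
Proof.
move=> u_x v_y; rewrite /homogeneous /= tqd_tens_act_dbase sum_lfunE.
rewrite (bigD1 (x, y)) //= big1 => [|[y' z'] /= /andP[_]].
  by rewrite gamma1 scale1r tens_homE u_x v_y addr0.
rewrite xpair_eqE gamma1 scale1r tens_homE (dbase1_hom _ u_x).
rewrite (dbase1_hom _ v_y); case: eqP => _; last by rewrite tmul0l.
by case: eqP => _ //; rewrite tmul0r.
Qed.

(** Only the summand of $R$ indexed by the degree of [u] acts nontrivially. *)
Lemma tqd_braidingE M N x (u : M) (v : N) : homogeneous x u ->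
  tqd_braiding M N (tmul u v) = tmul (tqd_act N (gbar w x) v) u.
Proof.
move=> u_x; rewrite /tqd_braiding comp_lfunE.
rewrite /tqd_R linear_sum sum_lfunE (bigD1 x) //= big1 => [|y y_x].
  by rewrite addr0 tens_actE tens_homE u_x tens_flipE.
by rewrite tens_actE tens_homE (dbase1_hom _ u_x) (negPf y_x) tmul0l.
Qed.

Lemma tens_act3E M N P (a b c : tqd w) (u : M) (v : N) (t : P) :
  tens_act (tqd_act M) (tens_act (tqd_act N) (tqd_act P))
    (tmul a (tmul b c)) (tmul u (tmul v t)) =
  tmul (tqd_act M a u) (tmul (tqd_act N b v) (tqd_act P c t)).
Proof. by rewrite tens_actE tens_homE /= tens_actE tens_homE. Qed.

Lemma tqd_assocE M N P a b c (u : M) (v : N) (t : P) :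
  homogeneous a u -> homogeneous b v -> homogeneous c t ->
  tqd_assoc M N P (tmul (tmul u v) t) = (w a b c)^-1 *: tmul u (tmul v t).
Proof.
move=> u_a v_b t_c; rewrite /tqd_assoc comp_lfunE tens_reassocE.
rewrite /tqd_Phi linear_sum sum_lfunE (bigD1 a) //= [X in _ + X]big1.
  rewrite addr0 linear_sum sum_lfunE (bigD1 b) //= [X in _ + X]big1.
    rewrite addr0 linear_sum sum_lfunE (bigD1 c) //= [X in _ + X]big1.
      by rewrite addr0 linearZ_LR scale_lfunE tens_act3E u_a v_b t_c.
    move=> c' /negPf c'_c; rewrite linearZ_LR scale_lfunE tens_act3E.
    by rewrite (dbase1_hom _ t_c) c'_c !tmul0r scaler0.
  move=> b' /negPf b'_b; rewrite linear_sum sum_lfunE big1 // => c' _.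
  rewrite linearZ_LR scale_lfunE tens_act3E.
  by rewrite (dbase1_hom _ v_b) b'_b tmul0l tmul0r scaler0.
move=> a' /negPf a'_a; rewrite linear_sum sum_lfunE big1 // => b' _.
rewrite linear_sum sum_lfunE big1 // => c' _.
rewrite linearZ_LR scale_lfunE tens_act3E.
by rewrite (dbase1_hom _ u_a) a'_a tmul0l scaler0.
Qed.

(** Tensors of homogeneous vectors are reached up to the nonzero scalar $\omega(a,b,c)^{-1}$, and
    they span. *)
Lemma limg_tqd_assoc M N P : limg (tqd_assoc M N P) = fullv.
Proof.
have Uabc a b c u v t : homogeneous a u -> homogeneous b v ->
    homogeneous c t -> tmul u (tmul v t) \in limg (tqd_assoc M N P).
  move=> u_a v_b t_c.
  apply: (@memvZ_inv _ _ _ (w a b c)^-1).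
    by rewrite invr_eq0 cocycle_neq0.
  by rewrite -(tqd_assocE u_a v_b t_c) memv_img ?memvf.
apply: (@tens_span _ M (tens N P)) => u s.
rewrite (homogeneous_sum u) tmul_suml.
apply: memv_suml => a _.
set u_a := tqd_act M _ u.
have u_aP : homogeneous a u_a by apply: dbase_homogeneous.
(* The two inner factors are handled through the preimage under $s \mapsto u_a \otimes s$. *)
pose fL := GRing.isLinear.Build _ _ _ _ (tmul u_a : tens N P -> _)
  (tmul_linearr u_a).
pose f : {linear tens N P -> _} := HB.pack (tmul u_a : tens N P -> _) fL.
suff fU : (linfun f @^-1: limg (tqd_assoc M N P))%VS = fullv.
  have : s \in (linfun f @^-1: limg (tqd_assoc M N P))%VS by rewrite fU memvf.
  by rewrite -memv_preim lfunE.
apply: (@homogeneous_tens_span N P) => b c v t v_b t_c.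
by rewrite -memv_preim lfunE; exact: (Uabc a b c u_a v t).
Qed.

Lemma lker0_tqd_assoc M N P : lker (tqd_assoc M N P) == 0%VS.
Proof. exact: surjective_lker0 (tens_dimA _ _ _) (limg_tqd_assoc _ _ _). Qed.

Lemma tqd_assocVE M N P a b c (u : M) (v : N) (t : P) :
  homogeneous a u -> homogeneous b v -> homogeneous c t ->
  (tqd_assoc M N P)^-1%VF (tmul u (tmul v t)) = w a b c *: tmul (tmul u v) t.
Proof.
move=> u_a v_b t_c; apply: (lker0P (lker0_tqd_assoc M N P)).
rewrite limg_lfunVK ?limg_tqd_assoc ?memvf // linearZ /=.
by rewrite (tqd_assocE u_a v_b t_c) scalerA mulfV ?scale1r // cocycle_neq0.
Qed.


End Homogeneous.

(** * Crossings on pure tensors of homogeneous vectors *)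

Section PureTensors.
Variables (gT : finGroupType) (k : fieldType) (w : cocycle3 gT k).
Variable V : tqd_module w.
Implicit Types (x : nat -> gT) (v : nat -> V).

(** Vectors are indexed by all of [nat] to avoid bounds on positions; only the entries 0 to [m]
    matter, see [eq_pure]. *)
Fixpoint pure m v : tpow_succ V m :=
  match m return tpow_succ V m with
  | 0 => v 0%N
  | m'.+1 => tmul (pure m' v) (v m'.+1)
  end.

Definition prefix_prod x i : gT := (\prod_(j < i) x j)%g.

Lemma eq_pure m v v' : (forall j, (j <= m)%N -> v j = v' j) ->
  pure m v = pure m v'.
Proof.
elim: m => [|m IHm] vv' /=; first exact: vv'.
by rewrite vv' // IHm // => j le_jm; apply: vv'; apply: ltnW.
Qed.

Lemma prefix_prodS x i : prefix_prod x i.+1 = (prefix_prod x i * x i)%g.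
Proof. by rewrite /prefix_prod big_ord_recr. Qed.

Lemma pure_homogeneous m x v :
  (forall j, (j <= m)%N -> homogeneous (x j) (v j)) ->
  homogeneous (prefix_prod x m.+1) (pure m v).
Proof.
elim: m => [|m IHm] x_v /=.
  by rewrite prefix_prodS /prefix_prod big_ord0 mul1g; apply: x_v.
rewrite prefix_prodS; apply: tmul_homogeneous; last exact: x_v.
by apply: IHm => j le_jm; apply: x_v; apply: ltnW.
Qed.

(** Induction on [m], taking preimages of [U] first under tensoring with a fixed last factor, then
    under tensoring with a fixed initial part. *)
Lemma pure_span m (S : V -> Prop) (U : {vspace tpow_succ V m}) :
  (forall W : {vspace V}, (forall a, S a -> a \in W) -> W = fullv) ->
  (forall v, (forall j, S (v j)) -> pure m v \in U) -> U = fullv.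
Proof.
move=> S_span; elim: m U => [|m IHm] U S_U.
  by apply: S_span => a Sa; apply: (S_U (fun=> a)).
have tU t a : S a -> tmul t a \in U.
  move=> Sa.
  pose fL := GRing.isLinear.Build _ _ _ _
    ((fun t => tmul t a) : tpow_succ V m -> tens _ _) (tmul_linearl a).
  pose f : {linear tpow_succ V m -> tens (tpow_succ V m) V} :=
    HB.pack (fun t : tpow_succ V m => tmul t a) fL.
  suff : t \in (linfun f @^-1: U)%VS by rewrite -memv_preim lfunE.
  rewrite (IHm (linfun f @^-1: U)%VS) ?memvf // => v Sv.
  rewrite -memv_preim lfunE /=.
  pose v' j := if j == m.+1 then a else v j.
  have v'a : v' m.+1 = a by rewrite /v' eqxx.
  have := S_U v'; rewrite /= v'a.
  rewrite (@eq_pure m v' v) => [-> // j|j].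
    by rewrite /v'; case: ifP.
  by rewrite /v' leqNgt; case: eqP => // ->; rewrite ltnSn.
apply: (@tens_span _ (tpow_succ V m) V) => t a.
pose fL := GRing.isLinear.Build _ _ _ _
  (tmul t : V -> tens (tpow_succ V m) V) (tmul_linearr t).
pose f : {linear V -> tens (tpow_succ V m) V} :=
  HB.pack (tmul t : V -> tens _ _) fL.
suff : a \in (linfun f @^-1: U)%VS by rewrite -memv_preim lfunE.
rewrite (S_span (linfun f @^-1: U)%VS) ?memvf // => b Sb.
by rewrite -memv_preim lfunE; apply: tU.
Qed.

(** Here [p] is the total degree to the left of the two strands, of degrees [a] and [b]. The
    associator contributes the denominator, and its inverse after the crossing the numerator. *)
Definition braid_coef (p a b : gT) : k := w p (b ^ a^-1)%g a / w p a b.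

Lemma braid_last_pure m x v :
  (forall j, (j <= m.+1)%N -> homogeneous (x j) (v j)) ->
  braid_last V m (pure m.+1 v) =
    braid_coef (prefix_prod x m) (x m) (x m.+1) *:
    pure m.+1 (fun j => if j == m then tqd_act V (gbar w (x m)) (v m.+1)
                        else if j == m.+1 then v m else v j).
Proof.
case: m => [|m] x_v.
  (* With no strand on the left there is no associator, and [braid_coef] is 1 because $\omega$ is
     normalized. *)
  rewrite /= (tqd_braidingE _ (x_v 0%N isT)) /braid_coef /prefix_prod big_ord0.
  by rewrite !cocycle_normalized ?eqxx // divr1 scale1r.
set v' := fun j => _.
have gtpt := pure_homogeneous (fun j (le_jm : (j <= m)%N) =>
   x_v j (leq_trans le_jm (leq_trans (leqnSn m) (leqnSn _)))).
have x_1 := x_v m.+1 (leqnSn _); have x_2 := x_v m.+2 (leqnn _).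
have -> : pure m.+2 v' = tmul (tmul (pure m v)
    (tqd_act V (gbar w (x m.+1)) (v m.+2))) (v m.+1).
  have v'1 : v' m.+1 = tqd_act V (gbar w (x m.+1)) (v m.+2) by rewrite /v' eqxx.
  have v'2 : v' m.+2 = v m.+1 by rewrite /v' eqxx gtn_eqF.
  rewrite /= v'1 v'2; congr (tmul (tmul _ _) _).
  apply: eq_pure => j le_jm; rewrite /v'.
  by rewrite !ltn_eqF // ltnS // ltnW.
rewrite [braid_last _ _]/= 2!comp_lfunE [pure _ _]/=.
rewrite (tqd_assocE gtpt x_1 x_2) !linearZ /= tens_homE id_lfunE.
rewrite (tqd_braidingE _ x_1).
rewrite (tqd_assocVE gtpt (gbar_homogeneous _ x_2) x_1) scalerA.
by rewrite /braid_coef mulrC.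
Qed.

(** With all brackets to the left, the factors after the crossing are carried along by the identity,
    so the induction descends to [braid_last]. The scalar [c] makes room for the [theta] produced
    when [gbar] acts on a labelled vector. *)
Lemma Rcheck_pure m i x v v' c : (i < m)%N ->
  (forall j, (j <= m)%N -> homogeneous (x j) (v j)) ->
  tqd_act V (gbar w (x i)) (v i.+1) = c *: v' i -> v' i.+1 = v i ->
  (forall j, (j <= m)%N -> j != i -> j != i.+1 -> v' j = v j) ->
  Rcheck_succ V m i (pure m v) =
    (braid_coef (prefix_prod x i) (x i) (x i.+1) * c) *: pure m v'.
Proof.
move=> lt_im x_v v'_i v'_i1; elim: m lt_im x_v => // m IHm lt_im x_v v'_j.
rewrite [Rcheck_succ _ _ _]/=; case: ltnP => [lt_i'm | le_mi].
  rewrite [pure _ v]/= tens_homE id_lfunE IHm //; last first.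
  - by move=> j le_jm; apply: v'_j; apply: ltnW.
  - by move=> j le_jm; apply: x_v; apply: ltnW.
  by rewrite tmulZl /= v'_j // gtn_eqF // ltnS // ltnW.
have Di : i = m by apply/eqP; rewrite eqn_leq le_mi -ltnS lt_im.
rewrite -{m}Di in IHm lt_im x_v v'_j le_mi *.
rewrite (braid_last_pure x_v) -scalerA; congr (_ *: _).
case: i {IHm lt_im le_mi x_v} v'_i v'_i1 v'_j => [|i] v'_i v'_i1 v'_j.
  by rewrite /= v'_i v'_i1 tmulZl.
rewrite /= !eqxx gtn_eqF // v'_i v'_i1 tmulZr tmulZl.
congr (_ *: tmul (tmul _ _) _); apply: eq_pure => j le_ji.
have lt_ji1 : (j < i.+1)%N by [].
have lt_ji2 : (j < i.+2)%N by apply: ltnW.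
by rewrite !ltn_eqF // v'_j ?ltn_eqF // ltnW.
Qed.

End PureTensors.

(** * The braiding on labelled tensors *)

Section Coefficients.
Variables (gT : finGroupType) (k : fieldType) (w : cocycle3 gT k).
Implicit Types a b c g h p x y : gT.

Let w_neq0 := cocycle_neq0 w.

(** The 2-cochain with coboundary $\omega^{|G|}$, see [cocycle_expG]. *)
Definition orbit_prod a b : k := \prod_y w y a b.

Lemma orbit_prod_neq0 a b : orbit_prod a b != 0.
Proof. exact/prodf_neq0. Qed.

(* Multiply the cocycle identity for (y, a, b, c) over all y. *)
Lemma cocycle_expG a b c : w a b c ^+ #|gT| =
  orbit_prod b c * orbit_prod a (b * c)%g /
    (orbit_prod a b * orbit_prod (a * b)%g c).
Proof.
apply: (canRL (mulfK _)); first by rewrite mulf_neq0 ?orbit_prod_neq0.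
have -> : orbit_prod b c = \prod_y w (y * a)%g b c.
  by rewrite /orbit_prod (reindex_inj (mulIg a)).
have -> : w a b c ^+ #|gT| = \prod_(y : gT) w a b c by rewrite prodr_const.
rewrite /orbit_prod -!big_split; apply: eq_bigr => y _ /=.
by rewrite -(cocycleP w y a b c); ring.
Qed.

(** Writing $L$ for this function, $\theta_x(g,h)^{|G|} = L(x,gh)/(L(x,g)\,L(g^{-1}xg,h))$: it
    trivializes the power of [theta]. *)
Definition label_weight x g : k := orbit_prod x g / orbit_prod g (x ^ g)%g.

Lemma label_weight_neq0 x g : label_weight x g != 0.
Proof. by rewrite mulf_neq0 ?invr_eq0 ?orbit_prod_neq0. Qed.

(** The factor [theta] comes from the product of $\overline{a}$ with $\delta_b\overline{g}$, see
    [gbar_dbase]. *)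
Definition step_coef p a b g : k :=
  braid_coef w p a b * theta w (b ^ a^-1)%g a g.

Lemma step_coef_neq0 p a b g : step_coef p a b g != 0.
Proof.
by rewrite /step_coef /braid_coef /theta !(mulf_neq0, invr_eq0, w_neq0).
Qed.

(** The parameter [h] cancels; it stands for the group label of the strand of degree [a], so that
    numerator and denominator become the weights of the two sites after and before the crossing. *)
Lemma step_coef_expG p a b g h : step_coef p a b g ^+ #|gT| =
  (label_weight (b ^ a^-1)%g (a * g)%g / orbit_prod p (b ^ a^-1)%g *
   (label_weight a h / orbit_prod (p * b ^ a^-1)%g a)) /
  (label_weight a h / orbit_prod p a *
   (label_weight b g / orbit_prod (p * a)%g b)).
Proof.
rewrite /step_coef /braid_coef /theta !(exprMn, exprVn) !cocycle_expG.
have -> : (b ^ a^-1 * a = a * b)%g by rewrite -conjgCV.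
have -> : ((b ^ a^-1) ^ (a * g) = b ^ g)%g by rewrite -conjgM mulKg.
have -> : ((b ^ a^-1) ^ a = b)%g by rewrite conjgKV.
have -> : (g * b ^ g = b * g)%g by rewrite conjgE mulVKg.
rewrite /label_weight.
have -> : ((b ^ a^-1) ^ (a * g) = b ^ g)%g by rewrite -conjgM mulKg.
by field; rewrite ?orbit_prod_neq0.
Qed.

(** Brings [p] into the values of $\omega$ occurring in [theta], so that they can be compared with
    those in [braid_coef]. *)
Lemma cocycle_last p a b c pa ab bc :
  (pa = p * a)%g -> (ab = a * b)%g -> (bc = b * c)%g ->
  w a b c = w pa b c * w p a bc / (w p a b * w p ab c).
Proof.
by move=> -> -> ->; rewrite -(cocycleP w p a b c); field; rewrite !w_neq0.
Qed.

(* Both sides are the coefficient of a half twist of three strands of degrees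
   a, b, c, the last two with group labels g, h; since theta is a cocycle, the
   labels only contribute a common factor. *)
Lemma step_coef_artin p a b c g h :
  step_coef p a b g * step_coef (p * b ^ a^-1)%g a c h *
    step_coef p (b ^ a^-1)%g (c ^ a^-1)%g (a * h)%g =
  step_coef (p * a)%g b c h * step_coef p a (c ^ b^-1)%g (b * h)%g *
    step_coef (p * (c ^ b^-1) ^ a^-1)%g a b g.
Proof.
rewrite /step_coef.
set b' := (b ^ a^-1)%g; set c1 := (c ^ a^-1)%g; set cb := (c ^ b^-1)%g.
have ba : (b' * a = a * b)%g by rewrite /b' -conjgCV.
have ca : (c1 * a = a * c)%g by rewrite /c1 -conjgCV.
have cbb : (cb * b = b * c)%g by rewrite /cb -conjgCV.
have conjVM x y z : ((z ^ x^-1) ^ y^-1 = z ^ (y * x)^-1)%g.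
  by rewrite invMg conjgM.
have -> : (c1 ^ b'^-1 = cb ^ a^-1)%g by rewrite /c1 /cb !conjVM ba.
set c2 := (cb ^ a^-1)%g.
have c2a : (c2 * a = a * cb)%g by rewrite /c2 -conjgCV.
have c2J : (c2 ^ b' = c1)%g.
  by rewrite /c2 /cb conjVM -ba -conjVM conjgKV.
have c2b : (c2 * b' = b' * c1)%g by rewrite -c2J conjgE mulVKg.
have th1 := theta_assoc w c2 b' a h; rewrite c2J in th1.
have th2 := theta_assoc w c2 a b h; rewrite conjgKV -ba in th2.
(* This is the case $g=h=1$; by [theta_assoc] the labels multiply both sides by
   [theta w b' a g * theta w c2 (b' * a) h]. *)
suff main : braid_coef w p a b * braid_coef w (p * b')%g a c *
      braid_coef w p b' c1 * theta w c2 b' a =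
    braid_coef w (p * a)%g b c * braid_coef w p a cb *
      braid_coef w (p * c2)%g a b * theta w c2 a b.
  set PL := (X in X * theta w c2 b' a = _) in main.
  set PR := (X in _ = X * theta w c2 a b) in main.
  transitivity (theta w b' a g * PL *
      (theta w c2 b' a * theta w c2 (b' * a)%g h)).
    by rewrite th1 /PL; ring.
  transitivity (theta w b' a g * (PL * theta w c2 b' a) *
      theta w c2 (b' * a)%g h); first by ring.
  rewrite main; transitivity (theta w b' a g * PR *
      (theta w c2 a b * theta w c2 (b' * a)%g h)); first by ring.
  by rewrite th2 /PR; ring.
have Jc : (c2 ^ (b' * a) = c)%g by rewrite conjgM c2J conjgKV.
have Jb : (c2 ^ (a * b) = c)%g by rewrite -ba.
rewrite /braid_coef /theta Jc Jb c2J conjgKV -/b' -/c1 -/cb -/c2.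
have -> : (c1 ^ b'^-1 = c2)%g by rewrite -c2J conjgK.
rewrite (@cocycle_last p c2 b' a _ _ _ erefl (esym c2b) (esym ba)).
rewrite (@cocycle_last p b' a c _ _ _ erefl (esym ba) erefl).
rewrite (@cocycle_last p b' c1 a _ _ _ erefl erefl (esym ca)).
rewrite (@cocycle_last p c2 a b _ _ _ erefl (esym c2a) erefl).
rewrite (@cocycle_last p a b c _ _ _ erefl erefl erefl).
rewrite (@cocycle_last p a cb b _ _ _ erefl erefl (esym cbb)).
by field; rewrite !w_neq0.
Qed.

End Coefficients.

(** * The action of crossings on labels *)

Section States.
Variables (gT : finGroupType) (m : nat).

(* A label (x, g, t) stands for the vector delta_x \bar{g} t. *)
Definition label (T : Type) : Type := (gT * gT * T)%type.
Definition state (T : Type) : Type := {ffun 'I_m.+1 -> label T}.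

Section OneType.
Variable T : Type.
Implicit Types (p q : label T) (s : state T) (i j : nat).

(** Up to a scalar, $\overline{x}\,\delta_y\overline{h}\,t'$ is
    $\delta_{xyx^{-1}}\overline{xh}\,t'$: this is the new label of [q] once it has passed a strand
    of degree $x$. *)
Definition cross p q : label T :=
  ((q.1.1 ^ p.1.1^-1)%g, (p.1.1 * q.1.2)%g, q.2).
Definition uncross p q : label T :=
  ((p.1.1 ^ q.1.1)%g, (q.1.1^-1 * p.1.2)%g, p.2).

(** Positions are natural numbers so that [j.+1] needs no proof; beyond [m], [inord] falls back to
    position 0, whence the bounds in the lemmas. *)
Definition at_ s j : label T := s (inord j).
Definition degree s j : gT := (at_ s j).1.1.
Definition shift s j : gT := (at_ s j).1.2.

Definition move i s : state T :=
  [ffun j : 'I_m.+1 => if j == i :> nat then cross (at_ s i) (at_ s i.+1)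
                       else if j == i.+1 :> nat then at_ s i else s j].
Definition unmove i s : state T :=
  [ffun j : 'I_m.+1 => if j == i :> nat then at_ s i.+1
                       else if j == i.+1 :> nat
                       then uncross (at_ s i) (at_ s i.+1) else s j].

Lemma state_ext s s' :
  (forall j, (j <= m)%N -> at_ s j = at_ s' j) -> s = s'.
Proof.
move=> ss'; apply/ffunP => j.
by have := ss' j (ltn_ord j); rewrite /at_ inord_val.
Qed.

Lemma at_move i s j : (j <= m)%N -> at_ (move i s) j =
  if j == i then cross (at_ s i) (at_ s i.+1)
  else if j == i.+1 then at_ s i else at_ s j.
Proof. by move=> le_jm; rewrite /at_ ffunE inordK. Qed.

Lemma at_unmove i s j : (j <= m)%N -> at_ (unmove i s) j =
  if j == i then at_ s i.+1
  else if j == i.+1 then uncross (at_ s i) (at_ s i.+1) else at_ s j.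
Proof. by move=> le_jm; rewrite /at_ ffunE inordK. Qed.

Lemma crossK p q : uncross (cross p q) p = q.
Proof.
by case: p q => [[x g] t] [[y h] t']; rewrite /uncross /= conjgKV mulKg.
Qed.

Lemma uncrossK p q : cross q (uncross p q) = p.
Proof.
by case: p q => [[x g] t] [[y h] t']; rewrite /cross /= conjgK mulKVg.
Qed.

Lemma moveK i s : (i < m)%N -> unmove i (move i s) = s.
Proof.
move=> lt_im; apply: state_ext => j le_jm.
rewrite at_unmove // !at_move ?(ltnW lt_im) // !eqxx (gtn_eqF (ltnSn i)) crossK.
by case: eqP => [->|_] //; case: eqP => [->|_].
Qed.

Lemma unmoveK i s : (i < m)%N -> move i (unmove i s) = s.
Proof.
move=> lt_im; apply: state_ext => j le_jm.
rewrite at_move // !at_unmove ?(ltnW lt_im) // !eqxx (gtn_eqF (ltnSn i)).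
rewrite uncrossK.
by case: eqP => [->|_] //; case: eqP => [->|_].
Qed.

Lemma prefix_prod_lt_move i s j : (j <= i)%N -> (i < m)%N ->
  prefix_prod (degree (move i s)) j = prefix_prod (degree s) j.
Proof.
move=> le_ji lt_im; apply: eq_bigr => l _.
have lt_li : (l < i)%N := leq_trans (ltn_ord l) le_ji.
rewrite /degree at_move; last exact: ltnW (ltn_trans lt_li lt_im).
by rewrite !ltn_eqF // ltnW.
Qed.

Lemma prefix_prod_mid_move i s : (i < m)%N ->
  prefix_prod (degree (move i s)) i.+1 =
  (prefix_prod (degree s) i * degree s i.+1 ^ (degree s i)^-1)%g.
Proof.
move=> lt_im; rewrite prefix_prodS prefix_prod_lt_move //; congr (_ * _)%g.
by rewrite /degree at_move ?(ltnW lt_im) // eqxx.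
Qed.

(** Since $(xyx^{-1})x = xy$, a crossing preserves the product of the two degrees. *)
Lemma prefix_prod_gt_move i s j : (i.+1 < j)%N -> (j <= m.+1)%N -> (i < m)%N ->
  prefix_prod (degree (move i s)) j = prefix_prod (degree s) j.
Proof.
move=> lt_ij le_jm lt_im; elim: j lt_ij le_jm => // j IHj.
rewrite ltnS leq_eqVlt => /predU1P[<-|lt_ij] lt_jm.
  rewrite prefix_prodS prefix_prod_mid_move // !prefix_prodS.
  rewrite -[LHS]mulgA -[RHS]mulgA; congr (_ * _)%g.
  rewrite [degree (move _ _) _]/degree at_move // (gtn_eqF (ltnSn i)) eqxx.
 by rewrite [RHS]conjgCV.
rewrite !prefix_prodS (IHj lt_ij (ltnW lt_jm)); congr (_ * _)%g.
by rewrite /degree at_move // !gtn_eqF // ltnW.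
Qed.

Lemma move_far i j s : (i.+1 < j)%N -> (j < m)%N ->
  move i (move j s) = move j (move i s).
Proof.
move=> lt_ij lt_jm; have lt_jm' := ltnW lt_jm.
have lt_im : (i < m)%N := ltn_trans (ltnW lt_ij) lt_jm.
have lt_im' := ltnW lt_im.
have lt1 : (i < j)%N := ltnW lt_ij.
have lt2 : (i < j.+1)%N := ltnW lt1.
have lt3 : (i.+1 < j.+1)%N := lt1.
apply: state_ext => l le_lm; rewrite !at_move //.
rewrite (ltn_eqF lt1) (ltn_eqF lt2) (ltn_eqF lt3) (ltn_eqF lt_ij).
rewrite (gtn_eqF lt1) (gtn_eqF lt2) (gtn_eqF lt3) (gtn_eqF lt_ij).
have [->|_] := eqVneq l i; first by rewrite (ltn_eqF lt1) (ltn_eqF lt2).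
have [->|_] := eqVneq l i.+1; first by rewrite (ltn_eqF lt3) (ltn_eqF lt_ij).
by [].
Qed.

(** The strand passing the other two, of degrees $a$ and $b$, is acted on by $(aba^{-1})a$ on one
    side and by $ab$ on the other. *)
Lemma move_artin i s : (i.+1 < m)%N ->
  move i (move i.+1 (move i s)) = move i.+1 (move i (move i.+1 s)).
Proof.
move=> lt_i1m; have lt_im := ltnW lt_i1m; have le_im := ltnW lt_im.
have ne1 : (i == i.+1) = false by rewrite ltn_eqF.
have ne2 : (i == i.+2) = false by rewrite ltn_eqF // ltnW.
have ne3 : (i.+1 == i) = false by rewrite gtn_eqF.
have ne4 : (i.+2 == i) = false by rewrite gtn_eqF // ltnW.
have ne5 : (i.+1 == i.+2) = false by rewrite ltn_eqF.
have ne6 : (i.+2 == i.+1) = false by rewrite gtn_eqF.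
apply: state_ext => l le_lm.
do !rewrite at_move // ?eqxx ?ne1 ?ne2 ?ne3 ?ne4 ?ne5 ?ne6.
have [->|nei] := eqVneq l i.
  rewrite ne1 ne2 /cross /=; congr (_, _, _); last first.
    by rewrite mulgA -conjgCV mulgA.
  by rewrite -!conjgM; congr (_ ^ _)%g; rewrite -!invMg -conjgCV.
by have [_|_] := eqVneq l i.+1; have [_|_] := eqVneq l i.+2.
Qed.

End OneType.

(* These maps commute with left translation by G, hence with the crossings. *)
Section Relabel.
Variables (T T0 : Type) (psi : T -> gT) (phi : T -> T0).

Definition relabel (p : label T) : label T0 :=
  (p.1.1, (p.1.2 * psi p.2)%g, phi p.2).
Definition relabel_state (s : state T) : state T0 := [ffun j => relabel (s j)].

Lemma at_relabel s j : at_ (relabel_state s) j = relabel (at_ s j).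
Proof. by rewrite /at_ ffunE. Qed.

Lemma move_relabel i s : (i < m)%N ->
  move i (relabel_state s) = relabel_state (move i s).
Proof.
move=> lt_im; apply: state_ext => j le_jm.
rewrite at_relabel !at_move // !at_relabel.
by case: ifP => // _; [rewrite /cross /relabel /= mulgA | case: ifP].
Qed.

Lemma unmove_relabel i s : (i < m)%N ->
  unmove i (relabel_state s) = relabel_state (unmove i s).
Proof.
move=> lt_im; apply: state_ext => j le_jm.
rewrite at_relabel !at_unmove // !at_relabel.
case: ifP => // _; case: ifP => // _.
by rewrite /uncross /relabel /= mulgA.
Qed.

End Relabel.

End States.

(** * Coefficients of crossings and their rescaling to roots of unity *)

Section MoveCoefficients.
Variables (gT : finGroupType) (k : fieldType) (w : cocycle3 gT k) (m : nat).
Variables (root : k -> k).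
Hypothesis rootP : forall z, root z ^+ #|gT| = z.

Section OneType.
Variable T : Type.
Implicit Types (s : state gT m T) (i j : nat).

Definition move_coef i s : k := step_coef w
  (prefix_prod (degree s) i) (degree s i) (degree s i.+1) (shift s i.+1).

(* By step_coef_expG, the |G|-th power of move_coef is the coboundary of the
   product of these factors. *)
Definition site_weight s j : k :=
  label_weight w (degree s j) (shift s j) /
    orbit_prod w (prefix_prod (degree s) j) (degree s j).

Definition weight s : k := \prod_(j < m.+1) site_weight s j.

Lemma site_weight_neq0 s j : site_weight s j != 0.
Proof. by rewrite mulf_neq0 ?invr_eq0 ?label_weight_neq0 ?orbit_prod_neq0. Qed.

Lemma weight_neq0 s : weight s != 0.
Proof. by apply/prodf_neq0 => j _; apply: site_weight_neq0. Qed.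

Lemma move_coef_neq0 i s : move_coef i s != 0.
Proof. exact: step_coef_neq0. Qed.

Lemma site_weight_move i s j : (i < m)%N -> (j <= m)%N -> j != i ->
  j != i.+1 -> site_weight (move i s) j = site_weight s j.
Proof.
move=> lt_im le_jm nji nji1; rewrite /site_weight.
rewrite /degree /shift at_move // (negPf nji) (negPf nji1) -/(degree _).
congr (_ / orbit_prod w _ _).
have [le_ji|lt_ij] := leqP j i; first exact: prefix_prod_lt_move.
by apply: prefix_prod_gt_move; rewrite // ?leqW // ltn_neqAle eq_sym nji1.
Qed.

(** The weights of the sites other than [i] and [i.+1] cancel; these two give [step_coef_expG], with
    [h] the group label at [i]. *)
Lemma move_coef_expG i s : (i < m)%N ->
  move_coef i s ^+ #|gT| = weight (move i s) / weight s.
Proof.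
move=> lt_im; have lt_im' := ltnW lt_im.
have ni : (i.+1 == i) = false by rewrite gtn_eqF.
pose o : 'I_m.+1 := inord i; pose o' : 'I_m.+1 := inord i.+1.
have oE : o = i :> nat by rewrite inordK.
have o'E : o' = i.+1 :> nat by rewrite inordK.
have no : o' != o by rewrite -val_eqE /= oE o'E ni.
have split_w s' : weight s' = site_weight s' i * site_weight s' i.+1 *
    \prod_(j | (j != o) && (j != o')) site_weight s' j.
  by rewrite /weight (bigD1 o) //= (bigD1 o') //= oE o'E mulrA.
rewrite !split_w.
have -> : \prod_(j | (j != o) && (j != o')) site_weight (move i s) j =
    \prod_(j | (j != o) && (j != o')) site_weight s j.
  apply: eq_bigr => j /andP[njo njo']; apply: site_weight_move => //.
  - by rewrite -ltnS ltn_ord.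
  - by rewrite -oE val_eqE.
  - by rewrite -o'E val_eqE.
rewrite -mulf_div divff ?mulr1; last first.
  by apply/prodf_neq0 => j _; apply: site_weight_neq0.
rewrite /move_coef (step_coef_expG _ _ _ _ _ (shift s i)) /site_weight.
rewrite prefix_prod_mid_move // prefix_prod_lt_move // prefix_prodS.
by rewrite /degree /shift !at_move // eqxx ni eqxx.
Qed.

Definition scale s : k := root (weight s).

Lemma scale_neq0 s : scale s != 0.
Proof.
have gT_gt0 : (0 < #|gT|)%N by rewrite (cardD1 (1%g : gT)).
by have := weight_neq0 s; rewrite -(rootP (weight s)) expf_eq0 gT_gt0.
Qed.

(** The coefficient of the crossing after each state vector is multiplied by its [scale]. *)
Definition root_coef i s : k := scale s * move_coef i s / scale (move i s).

Lemma root_coef_neq0 i s : root_coef i s != 0.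
Proof.
apply: mulf_neq0; last by rewrite invr_eq0 scale_neq0.
by apply: mulf_neq0; [exact: scale_neq0 | exact: move_coef_neq0].
Qed.

Lemma root_coef_expG i s : (i < m)%N -> root_coef i s ^+ #|gT| = 1.
Proof.
move=> lt_im; rewrite /root_coef expr_div_n exprMn !rootP move_coef_expG //.
by field; rewrite !weight_neq0.
Qed.

Lemma move_coef_artin i s : (i.+1 < m)%N ->
  move_coef i s * move_coef i.+1 (move i s) *
    move_coef i (move i.+1 (move i s)) =
  move_coef i.+1 s * move_coef i (move i.+1 s) *
    move_coef i.+1 (move i (move i.+1 s)).
Proof.
move=> lt_i1m; have lt_im := ltnW lt_i1m; have le_im := ltnW lt_im.
have ne1 : (i == i.+1) = false by rewrite ltn_eqF.
have ne2 : (i == i.+2) = false by rewrite ltn_eqF // ltnW.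
have ne3 : (i.+1 == i) = false by rewrite gtn_eqF.
have ne4 : (i.+2 == i) = false by rewrite gtn_eqF // ltnW.
have ne5 : (i.+1 == i.+2) = false by rewrite ltn_eqF.
have ne6 : (i.+2 == i.+1) = false by rewrite gtn_eqF.
rewrite /move_coef !(prefix_prod_lt_move _ (leqnSn i)) //.
rewrite !prefix_prod_mid_move // !prefix_prod_lt_move // ?prefix_prodS.
rewrite /degree /shift.
do !rewrite at_move // ?eqxx ?ne1 ?ne2 ?ne3 ?ne4 ?ne5 ?ne6.
exact: step_coef_artin.
Qed.

Lemma move_coef_far i j s : (i.+1 < j)%N -> (j < m)%N ->
  move_coef i (move j s) = move_coef i s /\
  move_coef j (move i s) = move_coef j s.
Proof.
move=> lt_ij lt_jm; have lt_jm' := ltnW lt_jm.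
have lt_im : (i < m)%N := ltn_trans (ltnW lt_ij) lt_jm.
have lt_im' := ltnW lt_im.
have lt1 : (i < j)%N := ltnW lt_ij.
have lt2 : (i < j.+1)%N := ltnW lt1.
have lt3 : (i.+1 < j.+1)%N := lt1.
rewrite /move_coef prefix_prod_lt_move ?(ltnW lt1) // prefix_prod_gt_move //;
  last exact: leqW.
rewrite /degree /shift !at_move //.
rewrite (ltn_eqF lt1) (ltn_eqF lt2) (ltn_eqF lt3) (ltn_eqF lt_ij).
by rewrite (gtn_eqF lt1) (gtn_eqF lt2) (gtn_eqF lt3) (gtn_eqF lt_ij).
Qed.

Implicit Types (l : 'I_m * bool) (u v : seq ('I_m * bool)).

Definition letter_move l s := if l.2 then move l.1 s else unmove l.1 s.
Definition letter_coef l s :=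
  if l.2 then root_coef l.1 s else (root_coef l.1 (unmove l.1 s))^-1.

Definition word_move u s := foldr letter_move s u.
Fixpoint word_coef u s : k :=
  if u is l :: u' then letter_coef l (word_move u' s) * word_coef u' s else 1.

Lemma word_move_cat u v s : word_move (u ++ v) s = word_move u (word_move v s).
Proof. exact: foldr_cat. Qed.

Lemma word_coef_cat u v s :
  word_coef (u ++ v) s = word_coef u (word_move v s) * word_coef v s.
Proof.
elim: u => [|l u IHu] /=; first by rewrite mul1r.
by rewrite IHu word_move_cat mulrA.
Qed.

Lemma word_coef_expG u s : word_coef u s ^+ #|gT| = 1.
Proof.
elim: u => [|[i b] u IHu] /=; first by rewrite expr1n.
rewrite exprMn IHu mulr1 /letter_coef /=.
by case: b; rewrite ?exprVn root_coef_expG ?invr1.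
Qed.

Definition inv_word u := rev [seq (l.1, ~~ l.2) | l <- u].

Lemma inv_wordK u s : word_move (inv_word u) (word_move u s) = s /\
  word_coef (inv_word u) (word_move u s) * word_coef u s = 1.
Proof.
elim: u s => [|[i b] u IHu] s /=; first by rewrite mulr1.
have [IH1 IH2] := IHu s.
rewrite /inv_word /= rev_cons -cats1 word_move_cat word_coef_cat /=.
set s' := word_move u s in IH1 IH2 *.
have -> : letter_move (i, ~~ b) (letter_move (i, b) s') = s'.
  by rewrite /letter_move; case: b => /=; rewrite (moveK, unmoveK).
split=> //; rewrite mulr1.
have letterK : letter_coef (i, ~~ b) (letter_move (i, b) s') *
    letter_coef (i, b) s' = 1.
  rewrite /letter_coef /letter_move; case: b => /=.
    by rewrite moveK // mulVf // root_coef_neq0.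
  by rewrite mulfV // root_coef_neq0.
by rewrite -mulrA (mulrA (letter_coef _ _)) letterK mul1r.
Qed.

Lemma inv_wordVK u s : word_move u (word_move (inv_word u) s) = s.
Proof.
have uK : inv_word (inv_word u) = u.
  rewrite /inv_word map_rev revK -map_comp -[RHS]map_id.
  by apply: eq_map => -[i b] /=; rewrite negbK.
by rewrite -{1}uK; case: (inv_wordK (inv_word u) s).
Qed.

End OneType.

Section Relabel.
Variables (T T0 : Type) (psi : T -> gT) (phi : T -> T0).
Implicit Types (s : state gT m T) (u : seq ('I_m * bool)).

Lemma word_move_relabel u s :
  word_move u (relabel_state psi phi s) = relabel_state psi phi (word_move u s).
Proof.
elim: u => //= -[i b] u ->; rewrite /letter_move /=.
by case: b; rewrite (move_relabel, unmove_relabel).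
Qed.

End Relabel.

Section Rename.
Variables (T T0 : Type) (phi : T -> T0).
Implicit Types (s : state gT m T) (u : seq ('I_m * bool)).
Let rename s := relabel_state (fun=> 1%g) phi s.

Lemma degree_rename s : degree (rename s) = degree s.
Proof. by apply: funext => j; rewrite /degree at_relabel. Qed.

Lemma shift_rename s : shift (rename s) = shift s.
Proof. by apply: funext => j; rewrite /shift at_relabel /= mulg1. Qed.

Lemma scale_rename s : scale (rename s) = scale s.
Proof.
congr root; apply: eq_bigr => j _.
by rewrite /site_weight degree_rename shift_rename.
Qed.

Lemma root_coef_rename i s : (i < m)%N ->
  root_coef i (rename s) = root_coef i s.
Proof.
move=> lt_im; rewrite /root_coef /move_coef move_relabel // !scale_rename.
by rewrite degree_rename shift_rename.
Qed.

(** Coefficients read only the degrees and group labels, so they can be computed over any type of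
    vector labels. *)
Lemma word_coef_rename u s : word_coef u (rename s) = word_coef u s.
Proof.
elim: u => //= -[i b] u ->; rewrite word_move_relabel; congr (_ * _).
rewrite /letter_coef /=; case: b; first exact: root_coef_rename.
by rewrite unmove_relabel // root_coef_rename.
Qed.

End Rename.

End MoveCoefficients.

(** * Braid words as operators and as monomial matrices *)

Section BraidOperators.
Variables (gT : finGroupType) (k : fieldType) (w : cocycle3 gT k).
Variables (V : tqd_module w) (m : nat).

Section Vectors.
Variables (T : Type) (iota : T -> V).
Hypothesis iota_span :
  forall U : {vspace V}, (forall t, iota t \in U) -> U = fullv.
Implicit Types s : state gT m T.

Definition label_vec (p : label gT T) : V :=
  tqd_act V (dbase w p.1.1 p.1.2) (iota p.2).
Definition state_vec s : tpow_succ V m :=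
  pure m (fun j => label_vec (at_ s j)).

(** Labels [(x, 1, t)] already suffice, as $t = \sum_x \delta_x t$. *)
Lemma state_vec_span (U : {vspace tpow_succ V m}) :
  (forall s, state_vec s \in U) -> U = fullv.
Proof.
move=> sU; apply: (@pure_span _ _ _ _ _ (fun v => exists p, v = label_vec p)).
  move=> W W_label; apply: iota_span => t.
  rewrite (homogeneous_sum (iota t)); apply: memv_suml => x _.
  by apply: W_label; exists ((x, 1%g), t).
move=> v /choice[p Dv].
have -> : pure m v = state_vec [ffun j : 'I_m.+1 => p j].
  by apply: eq_pure => j le_jm; rewrite Dv /at_ ffunE inordK.
exact: sU.
Qed.

Lemma Rcheck_state_vec i s : (i < m)%N ->
  Rcheck_succ V m i (state_vec s) = move_coef w i s *: state_vec (move i s).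
Proof.
move=> lt_im; rewrite /move_coef /step_coef.
apply: Rcheck_pure => // [j _|||j le_jm nji nji1].
- exact: dbase_homogeneous.
- rewrite at_move; last exact: ltnW.
  by rewrite eqxx /label_vec gbar_dbase.
- by rewrite at_move // gtn_eqF // eqxx.
- by rewrite at_move // (negPf nji) (negPf nji1).
Qed.

End Vectors.

Lemma id_span (U : {vspace V}) : (forall t, idfun t \in U) -> U = fullv.
Proof. exact: vspace_full. Qed.

(** The crossing is onto: up to a nonzero scalar, the vector of [s] is the image of that of
    [unmove i s]. *)
Lemma lker0_Rcheck i : (i < m)%N -> lker (Rcheck_succ V m i) == 0%VS.
Proof.
move=> lt_im; apply: surjective_lker0 => //.
apply: (state_vec_span id_span) => s.
apply: (@memvZ_inv _ _ _ (move_coef w i (unmove i s))).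
  exact: move_coef_neq0.
by rewrite -{2}(unmoveK s lt_im) -Rcheck_state_vec // memv_img ?memvf.
Qed.

Implicit Types u v : seq ('I_m * bool).

Definition letter_op (l : 'I_m * bool) : 'End(tpow_succ V m) :=
  if l.2 then Rcheck_succ V m l.1 else (Rcheck_succ V m l.1)^-1%VF.
Definition word_op u := foldr (fun l F => letter_op l \o F)%VF \1%VF u.

Lemma word_op_cat u v : word_op (u ++ v) = (word_op u \o word_op v)%VF.
Proof.
by elim: u => [|l u IHu] /=; rewrite ?comp_lfun1l // IHu comp_lfunA.
Qed.

(** The braid relations are tested on state vectors, where they reduce to the identities for moves
    and for coefficients; cancellation is the injectivity of crossings. *)
Lemma word_op_braid_rel (u v : braid_word m.+1) :
  braid_rel u v -> word_op u = word_op v.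
Proof.
elim=> {u v} // [u v z _ -> _ -> //|u u' v v' _ Eu _ Ev|i b|i j Dj|i j lt_ij].
- by rewrite !word_op_cat Eu Ev.
- rewrite /word_op /= comp_lfun1r /letter_op.
  case: b => /=; first by rewrite lker0_compfV // lker0_Rcheck.
  by rewrite lker0_compVf // lker0_Rcheck.
- rewrite /word_op /= !comp_lfun1r /letter_op /=.
  have lt_i1m : (i.+1 < m)%N by rewrite -Dj.
  have lt_im := ltnW lt_i1m.
  apply: (lfun_ext_span (state_vec_span id_span)) => s.
  rewrite !comp_lfunE Dj.
  do !rewrite ?linearZ /= Rcheck_state_vec //.
  rewrite !scalerA move_artin //; congr (_ *: _).
  transitivity (move_coef w i s * move_coef w i.+1 (move i s) *
    move_coef w i (move i.+1 (move i s))); first by ring.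
  by rewrite move_coef_artin //; ring.
- rewrite /word_op /= !comp_lfun1r /letter_op /=.
  have lt_jm := ltn_ord j; rewrite [X in (_ < X)%N]/= in lt_jm.
  have lt_im : (i < m)%N := ltn_ord i.
  apply: (lfun_ext_span (state_vec_span id_span)) => s.
  rewrite !comp_lfunE.
  do !rewrite ?linearZ /= Rcheck_state_vec //.
  have [-> ->] := move_coef_far w s lt_ij lt_jm.
  by rewrite !scalerA (move_far _ lt_ij lt_jm) mulrC.
Qed.

Variable root : k -> k.
Hypothesis rootP : forall z, root z ^+ #|gT| = z.

Lemma word_op_state_vec (T : Type) (iota : T -> V) u s :
  word_op u (scale w root s *: state_vec iota s) =
  word_coef w root u s *: (scale w root (word_move u s) *:
                           state_vec iota (word_move u s)).
Proof.
elim: u => [|[i b] u IHu] /=; first by rewrite id_lfunE scale1r.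
rewrite comp_lfunE IHu linearZ /= [in RHS]mulrC -[RHS]scalerA.
congr (_ *: _); set s' := word_move u s.
have Rs r : Rcheck_succ V m i (scale w root r *: state_vec iota r) =
    root_coef w root i r *: (scale w root (move i r) *:
       state_vec iota (move i r)).
  rewrite linearZ /= Rcheck_state_vec // !scalerA /root_coef.
  by rewrite mulfVK // scale_neq0.
rewrite /letter_op /letter_coef /letter_move /=; case: b => //.
(* For an inverse letter, both sides are compared after applying the injective crossing. *)
apply: (lker0P (lker0_Rcheck (ltn_ord i))).
rewrite lker0_lfunVK ?lker0_Rcheck // linearZ /= Rs unmoveK //.
by rewrite scalerK // root_coef_neq0.
Qed.

(** Labels over [T] are probed by maps to [T0]. Moves commute with relabelling, so agreement on
    [T0]-states, together with separation of labels, forces equal moves on [T]-states. Coefficients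
    transfer through the constant renaming to [t0]. *)
Lemma word_op_eq (T T0 : Type) (iota : T -> V) (t0 : T0) u v :
  (forall U : {vspace V}, (forall t, iota t \in U) -> U = fullv) ->
  (forall p q : label gT T,
     (forall psi (phi : T -> T0), relabel psi phi p = relabel psi phi q) ->
     p = q) ->
  (forall s : state gT m T0, word_move u s = word_move v s /\
     word_coef w root u s = word_coef w root v s) ->
  word_op u = word_op v.
Proof.
move=> iota_span sep uv; apply: (lfun_ext_span
  (b := fun s => scale w root s *: state_vec iota s)).
  move=> U sU; apply: (state_vec_span iota_span) => s.
  exact: memvZ_inv (scale_neq0 w rootP s) (sU s).
move=> s; rewrite !word_op_state_vec.
have <- := word_coef_rename w root (fun=> t0) u s.
have <- := word_coef_rename w root (fun=> t0) v s; rewrite (uv _).2.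
suff -> : word_move u s = word_move v s by [].
apply/ffunP => j; apply: sep => psi phi.
have [+ _] := uv (relabel_state psi phi s).
by rewrite !word_move_relabel => /ffunP/(_ j); rewrite !ffunE.
Qed.

End BraidOperators.

Local Open Scope classical_set_scope.

(** * Roots and roots of unity in the field *)

Section RootsOfUnity.
Variable k : closedFieldType.

Lemma closed_root (N : nat) : (0 < N)%N -> forall z : k, exists y, y ^+ N = z.
Proof.
(* [solve_monicpoly] solves $y^N = \sum_i P_i y^i$; here only $P_0 = z$ can be nonzero. *)
move=> N_gt0 z; have [y Dy] := solve_monicpoly (nth 0 [:: z]) N_gt0.
exists y; rewrite Dy; case: N N_gt0 {Dy} => // N _.
rewrite big_ord_recl /= expr0 mulr1 big1 ?addr0 // => j _.
by rewrite nth_nil mul0r.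
Qed.

Lemma unity_roots_seq (N : nat) : (0 < N)%N ->
  exists rs : seq k, forall z, z ^+ N = 1 -> z \in rs.
Proof.
move=> N_gt0; have [rs Drs] := closed_field_poly_normal ('X^N - 1 : {poly k}).
exists rs => z zN; have : root ('X^N - 1) z.
  by rewrite /root !hornerE zN subrr.
rewrite Drs rootZ ?root_prod_XsubC // lead_coef_eq0.
by rewrite -size_poly_eq0 size_XnsubC.
Qed.

End RootsOfUnity.

(* In characteristic l, the only l-power root of unity is 1. *)
Lemma expf_partn_pchar (k : fieldType) (N : nat) (z : k) : (0 < N)%N ->
  z ^+ N = 1 -> z ^+ (N`_[pchar k]^')%N = 1.
Proof.
move=> N_gt0 zN; have pN : [pchar k].-nat (N`_[pchar k])%N := part_pnat _ _.
(* The outer exponent is a power of the characteristic, or 1, so Frobenius turns the left side into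
   $z^N - 1$. *)
have /eqP : (z ^+ (N`_[pchar k]^')%N - 1) ^+ (N`_[pchar k])%N = 0.
  rewrite exprDn_pchar // exprNn_pchar // expr1n -exprM mulnC partnC //.
  by rewrite zN subrr.
by rewrite expf_eq0 subr_eq0 => /andP[_ /eqP].
Qed.

(** * Monomial matrices of a self-map with scalars *)

Section MonomialMatrices.
Variables (k : fieldType) (J : Type) (N : nat).
Variables (enc : J -> 'I_N) (dec : 'I_N -> J).
Hypotheses (encK : cancel enc dec) (decK : cancel dec enc).
Implicit Types (a b : J -> J) (c d : J -> k).

Definition monomial_mx a c : 'M[k]_N :=
  \matrix_(i, j) (if i == enc (a (dec j)) then c (dec j) else 0).

Lemma monomial_mxM a b c d : monomial_mx a c *m monomial_mx b d =
  monomial_mx (a \o b) (fun s => c (b s) * d s).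
Proof.
apply/matrixP => i j; rewrite !mxE (bigD1 (enc (b (dec j)))) //= big1.
  rewrite !mxE eqxx encK addr0; case: ifP => // _; exact: mul0r.
by move=> l /negPf nl; rewrite !mxE nl mulr0.
Qed.

Lemma monomial_mx1 : monomial_mx id (fun=> 1) = 1%:M.
Proof.
by apply/matrixP => i j; rewrite !mxE decK; case: eqP.
Qed.

Lemma monomial_mx_inj a b c d : (forall s, c s != 0) ->
  monomial_mx a c = monomial_mx b d -> forall s, a s = b s /\ c s = d s.
Proof.
move=> c_neq0 /matrixP E s; have := E (enc (a s)) (enc s).
rewrite !mxE encK eqxx; case: eqP => [Eab -> | _ /eqP].
  by split=> //; apply: can_inj encK _ _ Eab.
by rewrite (negPf (c_neq0 s)).
Qed.

Lemma monomial_mx_full a b c r : cancel a b -> cancel b a ->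
  (forall s, c s != 0) -> (forall s, c s ^+ r = 1) ->
  full_monomial r (monomial_mx a c).
Proof.
move=> aK bK c_neq0 c_r; split=> [i|j|i j].
- exists (enc (b (dec i))); split=> [|j].
    by rewrite mxE encK bK decK eqxx.
  by rewrite mxE; case: (i =P _) => [->|]; rewrite ?eqxx // encK aK decK.
- exists (enc (a (dec j))); split=> [|i]; first by rewrite mxE eqxx.
  by rewrite mxE; case: (i =P _) => [->|]; rewrite ?eqxx.
- by rewrite mxE; case: (i =P _) => // _; rewrite eqxx.
Qed.

End MonomialMatrices.

Lemma invmx_right (k : fieldType) (N : nat) (A B : 'M[k]_N) :
  B *m A = 1%:M -> invmx A = B.
Proof.
move=> BA; have [_ uA] := mulmx1_unit BA.
by rewrite -[RHS]mulmx1 -(mulmxV uA) mulmxA BA mul1mx.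
Qed.

(** * Finiteness of the image and its description by monomial matrices *)

Section Image.
Variables (k : closedFieldType) (gT : finGroupType) (w : cocycle3 gT k).
Variables (V : tqd_module w) (m : nat) (root : k -> k).
Hypothesis rootP : forall z, root z ^+ #|gT| = z.
Local Notation word := (seq ('I_m * bool)).

Let gT_gt0 : (0 < #|gT|)%N.
Proof. by rewrite (cardD1 (1%g : gT)). Qed.

Lemma word_coef_neq0 (T : Type) (u : word) (s : state gT m T) :
  word_coef w root u s != 0.
Proof.
by have := word_coef_expG w rootP u s; apply: contra_eq_neq => ->;
  rewrite expr0n gtn_eqF // eq_sym oner_eq0.
Qed.

Lemma separate_bool (p q : label gT V) :
  (forall psi (phi : V -> bool), relabel psi phi p = relabel psi phi q) ->
  p = q.
Proof.
case: p q => [[x g] t] [[y h] t'] pq.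
(* Trivial [psi] exposes the group labels, and the indicator function of [t'] distinguishes the
   vectors. *)
have [-> /(mulIg _)-> tt'] := pq (fun=> 1%g) (eq_op^~ t').
by congr (_, _); apply/eqP; rewrite tt' eqxx.
Qed.

(** A word is coded by its moves and coefficients on states over [bool]. There are finitely many
    codes, and by [word_op_eq] the code determines the operator. *)
Lemma finite_word_ops :
  finite_set (range (fun u : word => word_op V u)).
Proof.
have [rs rsP] := unity_roots_seq k gT_gt0.
pose code := {ffun state gT m bool -> state gT m bool * seq_sub rs}.
pose encodes (D : code) u := forall s,
  (D s).1 = word_move u s /\ ssval (D s).2 = word_coef w root u s.
(* Codes that no word attains are sent to 0. *)
have /choice[f fP] (D : code) :
    exists F, forall u, encodes D u -> F = word_op V u.
  have [[u Du]|noD] := pselect (exists u, encodes D u); last first.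
    by exists 0 => u Du; case: noD; exists u.
  exists (word_op V u) => v Dv.
  apply: (word_op_eq (root := root) rootP true (@id_span _ _ _ V));
    first exact: separate_bool.
  by move=> s; rewrite -(Du s).1 -(Dv s).1 -(Du s).2 -(Dv s).2.
apply: (@sub_finite_set _ _ (f @` [set: code])); last first.
  by apply: finite_image; apply: finite_finset.
move=> _ [u _ <-].
have cu (s : state gT m bool) : word_coef w root u s \in rs.
  by apply: rsP; apply: word_coef_expG.
exists [ffun s => (word_move u s, SeqSub (cu s))] => //.
by apply: fP => s; rewrite ffunE.
Qed.

(** The matrices act on states over [unit], that is on $(G\times G)^{m+1}$, whence their size. The
    hypothesis makes the passage from matrices to operators well defined. *)
Lemma word_ops_monomial :
  (forall u v : word,
    (forall s : state gT m unit, word_move u s = word_move v s /\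
      word_coef w root u s = word_coef w root v s) ->
    word_op V u = word_op V v) ->
  quotient_of_subgroup_of_full_monomial
    (partn #|gT| [pchar k]^')%N (#|gT| ^ (2 * m.+1))%N
    (range (fun u : word => word_op V u)).
Proof.
move=> op_eq.
have card_state :
    #|{: {ffun 'I_m.+1 -> gT * gT * unit}}| = (#|gT| ^ (2 * m.+1))%N.
  by rewrite card_ffun !card_prod card_unit muln1 card_ord mulnn expnM.
pose enc (s : state gT m unit) : 'I_(#|gT| ^ (2 * m.+1)) :=
  cast_ord card_state (enum_rank s).
pose dec (i : 'I_(#|gT| ^ (2 * m.+1))) : state gT m unit :=
  enum_val (cast_ord (esym card_state) i).
have encK : cancel enc dec by move=> s; rewrite /dec cast_ordK enum_rankK.
have decK : cancel dec enc by move=> i; rewrite /enc enum_valK cast_ordKV.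
pose M (u : word) := monomial_mx enc dec (word_move u) (word_coef w root u).
have Mcat u v : M (u ++ v) = M u *m M v.
  rewrite /M (monomial_mxM encK) /=; congr monomial_mx; apply: funext => s.
    exact: word_move_cat.
  exact: word_coef_cat.
have M1 : M [::] = 1%:M by rewrite -(monomial_mx1 k decK).
have Minv u : invmx (M u) = M (inv_word u).
  apply: invmx_right; rewrite -Mcat -M1; congr monomial_mx; apply: funext => s.
    by rewrite word_move_cat (inv_wordK w rootP u s).1.
  by rewrite word_coef_cat (inv_wordK w rootP u s).2.
(* The morphism reads off any word with matrix [A]; other matrices are sent to 0. *)
have /choice[f fP] (A : 'M[k]_(#|gT| ^ (2 * m.+1))) :
    exists F, forall u, A = M u -> F = word_op V u.
  have [[u Au]|noA] := pselect (exists u, A = M u); last first.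
    by exists 0 => u Au; case: noA; exists u.
  exists (word_op V u) => v Av; apply: op_eq => s; rewrite Au in Av.
  exact: (monomial_mx_inj encK (@word_coef_neq0 _ u) Av).
have fM u : f (M u) = word_op V u by apply: fP.
exists (range M), f; split.
- move=> _ [u _ <-].
  apply: (monomial_mx_full encK decK (b := word_move (inv_word u))).
  + by move=> s; apply: (inv_wordK w rootP u s).1.
  + by move=> s; apply: (inv_wordVK w rootP u s).
  + exact: word_coef_neq0.
  + by move=> s; apply: expf_partn_pchar => //; apply: word_coef_expG.
- split; first by exists [::].
    by move=> _ _ [u _ <-] [v _ <-]; exists (u ++ v).
  by move=> _ [u _ <-]; exists (inv_word u).
- move=> _ _ [u _ <-] [v _ <-].
  by rewrite -Mcat !fM word_op_cat.
- rewrite image_comp; congr (_ @` _); apply: funext => u; exact: fM.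
Qed.

Lemma word_ops_quotient :
  ~ [/\ #|gT| = 1%N, (1 < m.+1)%N & (1 < \dim {:V})%N] ->
  quotient_of_subgroup_of_full_monomial
    (partn #|gT| [pchar k]^')%N (#|gT| ^ (2 * m.+1))%N
    (range (fun u : word => word_op V u)).
Proof.
move=> nondeg; apply: word_ops_monomial => u v uv.
(* For one strand there are no letters, hence only the empty word. *)
have [m0|m_gt0] := posnP m.
  have nil (t : word) : t = [::].
    by case: t => // -[[i lt_im] b] t; have := leq_trans lt_im (eq_leq m0).
  by rewrite (nil u) (nil v).
have [gT1|gT_n1] := eqVneq #|gT| 1%N; last first.
  apply: (word_op_eq (root := root) rootP tt (@id_span _ _ _ V)) uv.
  case=> [[x g] t] [[y h] t'] pq.
  have [-> /(mulIg _) Eg] := pq (fun=> 1%g) (fun=> tt).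
  rewrite Eg; congr (_, _); apply/eqP/negPn/negP => tt'.
  (* Over [unit] the map [phi] sees nothing, but a [psi] with distinct values at [t] and [t'] moves
     their difference into the group labels. *)
  have /card_gt1P[a [b [_ _ ab]]] : (1 < #|gT|)%N.
    by rewrite ltn_neqAle eq_sym gT_n1.
  have [_] := pq (fun z => if z == t then a else b) (fun=> tt).
  by rewrite Eg eqxx eq_sym (negPf tt') => /(mulgI _)/eqP; rewrite (negPf ab).
have dimV : (\dim {:V} <= 1)%N.
  by rewrite leqNgt; apply/negP => dimV; case: nondeg.
(* Here $G$ is trivial and $\dim V \le 1$: one vector spans $V$ (it is 0 if $V=0$), and there is
   only one label over [unit]. *)
pose iota (_ : unit) : V := vpick {:V}.
apply: (word_op_eq (root := root) rootP (iota := iota) tt) uv.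
- move=> U /(_ tt) U_v; apply/eqP; rewrite eqEsubv subvf /=.
  have [V0|Vn0] := eqVneq {:V}%VS 0%VS; first by rewrite V0 sub0v.
  have DV : <[vpick {:V}]>%VS == {:V}%VS.
    rewrite eqEdim subvf dim_vline vpick0 Vn0.
    by [].
  by rewrite -(eqP DV) -memvE.
- case=> [[x g] []] [[y h] []] _.
  have /fintype_le1P gT_eq : (#|gT| <= 1)%N by rewrite gT1.
  by rewrite (gT_eq x y) (gT_eq g h).
Qed.

End Image.

Theorem theorem4p2 (k : closedFieldType) (gT : finGroupType)
    (w : cocycle3 gT k) (V : tqd_module w) (n : nat) (n_gt0 : (0 < n)%N) :
  exists rho : braid n -> 'End(tpow V n),
    [/\ braid_representation rho,
        forall i : 'I_n.-1, rho (braid_gen i) = Rcheck V i,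
        finite_set (range rho) &
        ~ [/\ #|gT| = 1%N, (1 < n)%N & (1 < \dim {:V})%N] ->
        quotient_of_subgroup_of_full_monomial
          (partn #|gT| [pchar k]^')%N (#|gT| ^ (2 * n))%N (range rho)].
Proof.
case: n n_gt0 => // m _.
have gT_gt0 : (0 < #|gT|)%N by rewrite (cardD1 (1%g : gT)).
have /choice[root rootP] := closed_root (k := k) gT_gt0.
(* By [word_op_braid_rel] the chosen representative word does not matter. *)
pose rho (x : braid m.+1) : 'End(tpow V m.+1) :=
  word_op V (generic_quotient.repr (x : {eq_quot (braid_equiv m.+1)}%qT)).
have rhoE u : rho (braid_class u) = word_op V u.
  exact/word_op_braid_rel/word_class.
have class_surj x : exists u : braid_word m.+1, x = braid_class u.
  by eexists; rewrite -[LHS]class_word.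
have rangeE : range rho = range (fun u : seq ('I_m * bool) => word_op V u).
  apply/seteqP; split=> F [x _ <-]; first by eexists.
  by exists (@braid_class m.+1 x).
exists rho; split.
- split=> [|x y]; first exact: (rhoE [::]).
  have [u ->] := class_surj x; have [v ->] := class_surj y.
  by rewrite -[(_ * _)%g]/(braid_mul _ _) braid_mulE !rhoE word_op_cat.
- by move=> i; rewrite rhoE /word_op /= comp_lfun1r.
- by rewrite rangeE; apply: (finite_word_ops V m rootP).
- by rewrite rangeE; apply: (word_ops_quotient rootP).
Qed.
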